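(* Any extension of $LJ$ or $LK$ obtained by adding the Reflexivity Axiom $\Rightarrow t=t$ and some (at least one) of the rules $=_1$, $=_2$, $=_1^l$ and $=_2^l$ is adequate for intuitionistic (in the case of $LJ$) or classical (in the case of $LK$) first-order logic with equality, but it satisfies the cut elimination theorem (i.e. every sequent derivable in it has a derivation in it without the cut rule) if and only if it contains at least either both $=_1$ and $=_2$, or both $=_1$ and $=_1^l$, or both $=_2$ and $=_2^l$.
   Context: The language is first-order with equality, with infinitely many free object variables and at least one function symbol of positive arity; free and bound object variables are syntactically distinct, and terms contain only free variables. A sequent $\Gamma\Rightarrow\Delta$ consists of two finite sequences of formulae. $F\{v/t\}$ is the result of simultaneously replacing all occurrences of the free object variable $v$ in $F$ by the term $t$. $LK$ is Gentzen's classical sequent calculus: logical axioms $F\Rightarrow F$ for every formula $F$; the structural rules of left and right weakening, exchange and contraction, and the cut rule (from $\Gamma\Rightarrow\Delta,F$ and $\Lambda,F\Rightarrow\Theta$ infer $\Gamma,\Lambda\Rightarrow\Delta,\Theta$); and the usual left and right logical rules for $\neg,\wedge,\vee,\to,\forall,\exists$, where the left rule for $\forall$ and the right rule for $\exists$ may be instantiated with an arbitrary term. $LJ$ is Gentzen's intuitionistic calculus, in which all sequents have at most one formula in the succedent. Equality rules ($F$ any formula, $r,s$ terms, $v$ a free object variable occurring neither in $r$ nor in $s$): $(=_1)$: from $\Gamma\Rightarrow\Delta,F\{v/r\}$ infer $\Gamma,r=s\Rightarrow\Delta,F\{v/s\}$; $(=_2)$: from $\Gamma\Rightarrow\Delta,F\{v/r\}$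 infer $\Gamma,s=r\Rightarrow\Delta,F\{v/s\}$; $(=_1^l)$: from $\Gamma,F\{v/r\}\Rightarrow\Delta$ infer $\Gamma,F\{v/s\},r=s\Rightarrow\Delta$; $(=_2^l)$: from $\Gamma,F\{v/r\}\Rightarrow\Delta$ infer $\Gamma,F\{v/s\},s=r\Rightarrow\Delta$. In extensions of $LJ$, $\Delta=\emptyset$ in $=_1,=_2$ and $|\Delta|\le1$ in $=_1^l,=_2^l$. ''Adequate for intuitionistic (classical) first-order logic with equality'' means that the calculus derives the same sequents as $LJ^{(1)=}$ ($LK^{(1)=}$), the calculus obtained from $LJ$ ($LK$) by adding the Reflexivity Axiom and the rule: from $\Lambda\Rightarrow\Theta,F\{v/r\}$ and $\Gamma,F\{v/s\}\Rightarrow\Delta$ infer $\Lambda,\Gamma,r=s\Rightarrow\Theta,\Delta$ (with $\Theta=\emptyset$ and $|\Delta|\le 1$ in the intuitionistic case). *)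

(* Defs.v *)
From Stdlib Require List.
From mathcomp Require Import all_boot.

Set Implicit Arguments.
Unset Strict Implicit.
Unset Printing Implicit Defensive.

Record language := Language {
  fvar : eqType;
  fun_symb : Type;
  fun_arity : fun_symb -> nat;
  pred_symb : Type;
  pred_arity : pred_symb -> nat }.

(* Free variables are named, bound variables are de Bruijn indices, so the two
   kinds are syntactically distinct.  In [pterm L n] and [pformula L n] the
   dangling indices are those below n; genuine terms and formulae have none.
   Function symbols of arity 0 are the constants. *)
Inductive pterm (L : language) (n : nat) : Type :=
| FVar of fvar L
| BVar of 'I_n
| App (f : fun_symb L) of {ffun 'I_(fun_arity f) -> pterm L n}.

Arguments FVar {L n} _.
Arguments BVar {L n} _.
Arguments App {L n} f _.

Inductive pformula (L : language) : nat -> Type :=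
| Pred n (p : pred_symb L) of {ffun 'I_(pred_arity p) -> pterm L n} : pformula L n
| Equ n of pterm L n & pterm L n : pformula L n
| Neg n of pformula L n : pformula L n
| And n of pformula L n & pformula L n : pformula L n
| Or n of pformula L n & pformula L n : pformula L n
| Imp n of pformula L n & pformula L n : pformula L n
| All n of pformula L n.+1 : pformula L n
| Ex n of pformula L n.+1 : pformula L n.

Arguments Pred {L n} p _.

Notation term L := (pterm L 0).
Notation formula L := (pformula L 0).

(* Simultaneous substitution: r acts on free variables, s on dangling indices. *)
Fixpoint tsubst (L : language) m n (r : fvar L -> pterm L n)
    (s : 'I_m -> pterm L n) (t : pterm L m) : pterm L n :=
  match t with
  | FVar v => r v
  | BVar i => s i
  | App f a => App f [ffun i => tsubst r s (a i)]
  end.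

Definition tshift (L : language) n (t : pterm L n) : pterm L n.+1 :=
  tsubst FVar (fun i => BVar (lift ord0 i)) t.

Definition up (L : language) m n (s : 'I_m -> pterm L n) (i : 'I_m.+1) :
    pterm L n.+1 :=
  if unlift ord0 i is Some j then tshift (s j) else BVar ord0.

Fixpoint fsubst (L : language) m n (r : fvar L -> pterm L n)
    (s : 'I_m -> pterm L n) (F : pformula L m) : pformula L n :=
  match F in pformula _ m return ('I_m -> pterm L n) -> pformula L n with
  | Pred _ p a => fun s => Pred p [ffun i => tsubst r s (a i)]
  | Equ _ t u => fun s => Equ (tsubst r s t) (tsubst r s u)
  | Neg _ A => fun s => Neg (fsubst r s A)
  | And _ A B => fun s => And (fsubst r s A) (fsubst r s B)
  | Or _ A B => fun s => Or (fsubst r s A) (fsubst r s B)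
  | Imp _ A B => fun s => Imp (fsubst r s A) (fsubst r s B)
  | All _ A => fun s => All (fsubst (fun v => tshift (r v)) (up s) A)
  | Ex _ A => fun s => Ex (fsubst (fun v => tshift (r v)) (up s) A)
  end s.

(* F{v/t} *)
Definition repl (L : language) (F : formula L) (v : fvar L) (t : term L) :
    formula L :=
  fsubst (fun w => if w == v then t else FVar w) BVar F.

(* The instance of the body A of a quantified formula at the term t. *)
Definition inst_body (L : language) (A : pformula L 1) (t : term L) : formula L :=
  fsubst FVar (fun _ => t) A.

Fixpoint tocc (L : language) n (v : fvar L) (t : pterm L n) : bool :=
  match t with
  | FVar w => v == w
  | BVar _ => false
  | App f a => [exists i, tocc v (a i)]
  end.

Fixpoint focc (L : language) n (v : fvar L) (F : pformula L n) : bool :=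
  match F with
  | Pred _ p a => [exists i, tocc v (a i)]
  | Equ _ t u => tocc v t || tocc v u
  | Neg _ A => focc v A
  | And _ A B | Or _ A B | Imp _ A B => focc v A || focc v B
  | All _ A | Ex _ A => focc v A
  end.

Record sequent (L : language) :=
  Sequent { antecedent : seq (formula L); succedent : seq (formula L) }.

Notation "G ⇒ D" := (Sequent G D) (at level 70, no associativity).

(* [R ps c]: c is inferred from the premises ps; axioms have no premises. *)
Definition rule (L : language) := seq (sequent L) -> sequent L -> Prop.

Inductive derivable (L : language) (R : rule L) : sequent L -> Prop :=
| Infer ps c :
    R ps c -> (forall p, List.In p ps -> derivable R p) -> derivable R c.

Definition rule_or (L : language) (R R' : rule L) : rule L :=
  fun ps c => R ps c \/ R' ps c.

Notation "R '⊎' R'" := (rule_or R R') (at level 65, left associativity).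

Inductive logical_axiom (L : language) : rule L :=
| Ax F : logical_axiom [::] ([:: F] ⇒ [:: F]).

Inductive structural_rule (L : language) : rule L :=
| WeakL G D F : structural_rule [:: G ⇒ D] (G ++ [:: F] ⇒ D)
| WeakR G D F : structural_rule [:: G ⇒ D] (G ⇒ D ++ [:: F])
| ExchL G G' D A B :
    structural_rule [:: G ++ A :: B :: G' ⇒ D] (G ++ B :: A :: G' ⇒ D)
| ExchR G D D' A B :
    structural_rule [:: G ⇒ D ++ A :: B :: D'] (G ⇒ D ++ B :: A :: D')
| ContrL G D F : structural_rule [:: G ++ [:: F; F] ⇒ D] (G ++ [:: F] ⇒ D)
| ContrR G D F : structural_rule [:: G ⇒ D ++ [:: F; F]] (G ⇒ D ++ [:: F]).

Inductive cut_rule (L : language) : rule L :=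
| Cut G D G' D' F :
    cut_rule [:: G ⇒ D ++ [:: F]; G' ++ [:: F] ⇒ D'] (G ++ G' ⇒ D ++ D').

Inductive logical_rule (L : language) : rule L :=
| NegL G D A : logical_rule [:: G ⇒ D ++ [:: A]] (G ++ [:: Neg A] ⇒ D)
| NegR G D A : logical_rule [:: G ++ [:: A] ⇒ D] (G ⇒ D ++ [:: Neg A])
| AndL1 G D A B :
    logical_rule [:: G ++ [:: A] ⇒ D] (G ++ [:: And A B] ⇒ D)
| AndL2 G D A B :
    logical_rule [:: G ++ [:: B] ⇒ D] (G ++ [:: And A B] ⇒ D)
| AndR G D A B :
    logical_rule [:: G ⇒ D ++ [:: A]; G ⇒ D ++ [:: B]]
                 (G ⇒ D ++ [:: And A B])
| OrL G D A B :
    logical_rule [:: G ++ [:: A] ⇒ D; G ++ [:: B] ⇒ D]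
                 (G ++ [:: Or A B] ⇒ D)
| OrR1 G D A B : logical_rule [:: G ⇒ D ++ [:: A]] (G ⇒ D ++ [:: Or A B])
| OrR2 G D A B : logical_rule [:: G ⇒ D ++ [:: B]] (G ⇒ D ++ [:: Or A B])
| ImpL G D G' D' A B :
    logical_rule [:: G ⇒ D ++ [:: A]; G' ++ [:: B] ⇒ D']
                 (G ++ G' ++ [:: Imp A B] ⇒ D ++ D')
| ImpR G D A B :
    logical_rule [:: G ++ [:: A] ⇒ D ++ [:: B]] (G ⇒ D ++ [:: Imp A B])
| AllL G D A t :
    logical_rule [:: G ++ [:: inst_body A t] ⇒ D] (G ++ [:: All A] ⇒ D)
| AllR G D A v :
    ~~ has (focc v) (G ++ D) -> ~~ focc v A ->
    logical_rule [:: G ⇒ D ++ [:: inst_body A (FVar v)]] (G ⇒ D ++ [:: All A])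
| ExL G D A v :
    ~~ has (focc v) (G ++ D) -> ~~ focc v A ->
    logical_rule [:: G ++ [:: inst_body A (FVar v)] ⇒ D] (G ++ [:: Ex A] ⇒ D)
| ExR G D A t :
    logical_rule [:: G ⇒ D ++ [:: inst_body A t]] (G ⇒ D ++ [:: Ex A]).

Inductive reflexivity_axiom (L : language) : rule L :=
| Refl t : reflexivity_axiom [::] ([::] ⇒ [:: Equ t t]).

(* The names of the rules $=_1$, $=_2$, $=_1^l$ and $=_2^l$. *)
Inductive eq_name := Eq1 | Eq2 | Eq1l | Eq2l.

Inductive eq_rule (L : language) : eq_name -> rule L :=
| Eq1_rule G D F v r s : ~~ tocc v r -> ~~ tocc v s ->
    eq_rule Eq1 [:: G ⇒ D ++ [:: repl F v r]]
                (G ++ [:: Equ r s] ⇒ D ++ [:: repl F v s])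
| Eq2_rule G D F v r s : ~~ tocc v r -> ~~ tocc v s ->
    eq_rule Eq2 [:: G ⇒ D ++ [:: repl F v r]]
                (G ++ [:: Equ s r] ⇒ D ++ [:: repl F v s])
| Eq1l_rule G D F v r s : ~~ tocc v r -> ~~ tocc v s ->
    eq_rule Eq1l [:: G ++ [:: repl F v r] ⇒ D]
                 (G ++ [:: repl F v s; Equ r s] ⇒ D)
| Eq2l_rule G D F v r s : ~~ tocc v r -> ~~ tocc v s ->
    eq_rule Eq2l [:: G ++ [:: repl F v r] ⇒ D]
                 (G ++ [:: repl F v s; Equ s r] ⇒ D).

Inductive congruence_rule (L : language) : rule L :=
| Congr G D G' D' F v r s : ~~ tocc v r -> ~~ tocc v s ->
    congruence_rule [:: G ⇒ D ++ [:: repl F v r]; G' ++ [:: repl F v s] ⇒ D']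
                    (G ++ G' ++ [:: Equ r s] ⇒ D ++ D').

Inductive logic := LJ | LK.

(* LJ keeps the instances of the LK rules in which every sequent has at most
   one formula in the succedent; the same restriction turns each equality rule
   into its intuitionistic version. *)
Definition restrict (L : language) (c : logic) (R : rule L) : rule L :=
  match c with
  | LK => R
  | LJ => fun ps q =>
      R ps q /\ forall p, List.In p (q :: ps) -> size (succedent p) <= 1
  end.

Definition gentzen_cut_free (L : language) : rule L :=
  @logical_axiom L ⊎ @structural_rule L ⊎ @logical_rule L.

Definition eq_rules (L : language) (S : pred eq_name) : rule L :=
  fun ps c => exists2 e, S e & eq_rule e ps c.

(* LJ or LK with the Reflexivity Axiom and the equality rules in S, without
   and with cut. *)
Definition ext_cut_free (L : language) (c : logic) (S : pred eq_name) :
    rule L :=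
  restrict c (@gentzen_cut_free L ⊎ @reflexivity_axiom L ⊎ eq_rules S).

Definition ext (L : language) (c : logic) (S : pred eq_name) : rule L :=
  restrict c (@gentzen_cut_free L ⊎ @reflexivity_axiom L ⊎ eq_rules S
              ⊎ @cut_rule L).

(* $LJ^{(1)=}$ and $LK^{(1)=}$. *)
Definition reference (L : language) (c : logic) : rule L :=
  restrict c (@gentzen_cut_free L ⊎ @reflexivity_axiom L ⊎ @congruence_rule L
              ⊎ @cut_rule L).

Definition adequate (L : language) (c : logic) (S : pred eq_name) : Prop :=
  forall q : sequent L, derivable (ext c S) q <-> derivable (reference c) q.

Definition cut_elimination (L : language) (c : logic) (S : pred eq_name) :
    Prop :=
  forall q : sequent L, derivable (ext c S) q -> derivable (ext_cut_free c S) q.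

(* Main.v *)
Require Import Defs.
From mathcomp Require Import all_boot zify.
From Stdlib Require Import FunctionalExtensionality Relation_Operators.
From Stdlib Require Permutation.

(** Why the theorem is true.

    Say that an equation t = u follows from a list G of formulae ([eqv G t u])
    when it is obtained from the equations in G by reflexivity, symmetry,
    transitivity and congruence.  Call a calculus [equational] when it derives
    G ⇒ t = u for all such t and u, and also G, P(b) ⇒ P(a) when the arguments
    of a and b are equal in this sense.  The heart of the proof is that every
    equational calculus with the cut-free rules of LJ (or LK) already derives
    everything that cut, the four equality rules and the congruence rule can
    derive ([prov_of_ext], [prov_of_reference]).  This gives both halves of the
    positive part: adequacy, by comparing two calculi with cut, and cut
    elimination, by taking the target calculus to be cut-free.

    The argument is semantic.  Provability in the target calculus R makes the
    sets of contexts that are closed under a biorthogonal closure into a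
    complete Heyting algebra (a Boolean algebra for LK), and a formula A is
    interpreted by such a set [A].  The rules of R are just what is needed for
    the context A to lie in [A] and for every context in [A] to prove A
    ([sem_complete]); so a valid sequent is derivable in R.  Cut is sound in
    the model because it is mere inclusion of sets, and replacement of equals is
    sound because the atomic formulae are interpreted through [eqv].  Neither
    derivations nor cut formulae are ever transformed.

    It remains to see which calculi are equational.  With =_1 and =_2 an
    equation acts in both directions on the succedent, and induction on [eqv]
    suffices.  With =_1 and =_1^l, read from conclusion to premise, the
    right-hand side of an equation may be replaced by its left-hand side,
    everywhere but never backwards; the point is that the equations themselves
    can be rewritten too.  Adding all the equations so obtained gives a
    rewriting relation with the diamond property ([rewrites_diamond]), so that
    two equal terms have a common reduct ([joinable_eqv]), which both sides of
    a sequent can reach.  The rules =_2 and =_2^l are the mirror image.  In the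
    presence of cut, any single rule allows replacement in both directions
    ([equational_of_cut]).

    For the negative part, a set of rules that contains none of the three pairs
    has no right rule, or its right rule and its left rule (if any) rewrite in
    opposite senses.  In the first case the right-hand sides in
    a = b ⇒ f(a, ..., a) = f(b, ..., b) can never change.  In the second the
    sequent a = c, b = c ⇒ a = b (or c = a, c = b ⇒ a = b) is stuck: the only
    term that the right rule can rewrite is c, which does not occur in the
    succedent, and the left rule yields only c = c.  Both are invariants of
    cut-free derivations ([underivable_equations]). *)

Set Implicit Arguments.
Unset Strict Implicit.
Unset Printing Implicit Defensive.

(** * Substitution *)

Lemma pterm_nested_ind (L : language) n (P : pterm L n -> Prop) :
  (forall v, P (FVar v)) -> (forall i, P (BVar i)) ->
  (forall f (a : {ffun 'I_(fun_arity f) -> pterm L n}),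
     (forall i, P (a i)) -> P (App f a)) ->
  forall t, P t.
Proof.
move=> Pvar Pbound Papp; fix IH 1; case=> [v|i|f a].
- exact: Pvar.
- exact: Pbound.
- by apply: Papp => i; apply: IH.
Qed.

(** The environment of a body: the outermost dangling index denotes t. *)
Definition scons (L : language) m n (t : pterm L n) (s : 'I_m -> pterm L n)
    (i : 'I_m.+1) : pterm L n :=
  if unlift ord0 i is Some j then s j else t.

Section Substitution.
Variable L : language.
Implicit Types (v w : fvar L).

Lemma eq_tsubst m n (r r' : fvar L -> pterm L n) (s s' : 'I_m -> pterm L n) t :
  (forall v, tocc v t -> r v = r' v) -> s =1 s' ->
  tsubst r s t = tsubst r' s' t.
Proof.
move=> eq_r eq_s; elim/pterm_nested_ind: t eq_r => [v|i|f a IH] eq_r /=.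
- by apply: eq_r; rewrite /= eqxx.
- exact: eq_s.
- congr App; apply/ffunP => i; rewrite !ffunE; apply: IH => v v_ai.
  by apply: eq_r; apply/existsP; exists i.
Qed.

Lemma tsubst_tsubst m n p (r : fvar L -> pterm L n) (s : 'I_m -> pterm L n)
    (r' : fvar L -> pterm L p) (s' : 'I_n -> pterm L p) t :
  tsubst r' s' (tsubst r s t)
  = tsubst (fun v => tsubst r' s' (r v)) (fun i => tsubst r' s' (s i)) t.
Proof.
elim/pterm_nested_ind: t => //= f a IH.
by congr App; apply/ffunP => i; rewrite !ffunE.
Qed.

Lemma tsubst_id n (t : pterm L n) : tsubst FVar BVar t = t.
Proof.
elim/pterm_nested_ind: t => //= f a IH.
by congr App; apply/ffunP => i; rewrite !ffunE.
Qed.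

Lemma tsubst_scons_tshift m n (r : fvar L -> pterm L n) t (s : 'I_m -> pterm L n)
    (u : pterm L m) :
  tsubst r (scons t s) (tshift u) = tsubst r s u.
Proof.
rewrite /tshift tsubst_tsubst; apply: eq_tsubst => // i /=.
by rewrite /scons liftK.
Qed.

Lemma up_tsubst m n p (s : 'I_m -> pterm L n) (r' : fvar L -> pterm L p)
    (s' : 'I_n -> pterm L p) :
  up (fun i => tsubst r' s' (s i))
  =1 fun i => tsubst (fun v => tshift (r' v)) (up s') (up s i).
Proof.
move=> i; rewrite /up; case: unliftP => [j _|_] /=; last first.
  by rewrite unlift_none.
rewrite /tshift !tsubst_tsubst; apply: eq_tsubst => // k /=.
by rewrite liftK.
Qed.

Lemma up_BVar n : up (L := L) (n := n) BVar =1 BVar.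
Proof. by move=> i; rewrite /up; case: unliftP => [j ->|->]. Qed.

Lemma eq_up m n (s s' : 'I_m -> pterm L n) : s =1 s' -> up s =1 up s'.
Proof. by move=> eq_s i; rewrite /up; case: unlift => // j; rewrite eq_s. Qed.

Lemma eq_fsubst m n (F : pformula L m) (r r' : fvar L -> pterm L n)
    (s s' : 'I_m -> pterm L n) :
  (forall v, focc v F -> r v = r' v) -> s =1 s' ->
  fsubst r s F = fsubst r' s' F.
Proof.
elim: F n r r' s s' => {m} /=.
- move=> m p a n r r' s s' eq_r eq_s; congr Pred; apply/ffunP => i.
  rewrite !ffunE; apply: eq_tsubst => // v v_ai.
  by apply: eq_r; apply/existsP; exists i.
- move=> m t u n r r' s s' eq_r eq_s; congr Equ; apply: eq_tsubst => // v v_t;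
  by apply: eq_r; rewrite v_t ?orbT.
- by move=> m A IH n r r' s s' eq_r eq_s; congr Neg; apply: IH.
- move=> m A IHA B IHB n r r' s s' eq_r eq_s; congr And;
  by [apply: IHA => // v v_A; apply: eq_r; rewrite v_A
     |apply: IHB => // v v_B; apply: eq_r; rewrite v_B orbT].
- move=> m A IHA B IHB n r r' s s' eq_r eq_s; congr Or;
  by [apply: IHA => // v v_A; apply: eq_r; rewrite v_A
     |apply: IHB => // v v_B; apply: eq_r; rewrite v_B orbT].
- move=> m A IHA B IHB n r r' s s' eq_r eq_s; congr Imp;
  by [apply: IHA => // v v_A; apply: eq_r; rewrite v_A
     |apply: IHB => // v v_B; apply: eq_r; rewrite v_B orbT].
- move=> m A IH n r r' s s' eq_r eq_s; congr All; apply: IH; last exact: eq_up.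
  by move=> v v_A; rewrite eq_r.
- move=> m A IH n r r' s s' eq_r eq_s; congr Ex; apply: IH; last exact: eq_up.
  by move=> v v_A; rewrite eq_r.
Qed.

Lemma tsubst_tshift_tshift n p (r : fvar L -> pterm L p) (s : 'I_n -> pterm L p)
    (u : pterm L n) :
  tsubst (fun v => tshift (r v)) (up s) (tshift u) = tshift (tsubst r s u).
Proof.
rewrite /tshift !tsubst_tsubst; apply: eq_tsubst => // k /=.
by rewrite /up liftK.
Qed.

Lemma fsubst_fsubst m n p (F : pformula L m) (r : fvar L -> pterm L n)
    (s : 'I_m -> pterm L n) (r' : fvar L -> pterm L p) (s' : 'I_n -> pterm L p) :
  fsubst r' s' (fsubst r s F)
  = fsubst (fun v => tsubst r' s' (r v)) (fun i => tsubst r' s' (s i)) F.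
Proof.
elim: F n p r s r' s' => {m} /=.
- move=> m q a n p r s r' s'; congr Pred; apply/ffunP => i.
  by rewrite !ffunE tsubst_tsubst.
- by move=> m t u n p r s r' s'; rewrite !tsubst_tsubst.
- by move=> m A IH n p r s r' s'; rewrite IH.
- by move=> m A IHA B IHB n p r s r' s'; rewrite IHA IHB.
- by move=> m A IHA B IHB n p r s r' s'; rewrite IHA IHB.
- by move=> m A IHA B IHB n p r s r' s'; rewrite IHA IHB.
- move=> m A IH n p r s r' s'; rewrite IH; congr All; apply: eq_fsubst => [v _|i].
    exact: tsubst_tshift_tshift.
  by rewrite up_tsubst.
- move=> m A IH n p r s r' s'; rewrite IH; congr Ex; apply: eq_fsubst => [v _|i].
    exact: tsubst_tshift_tshift.
  by rewrite up_tsubst.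
Qed.

Lemma inst_body_fsubst n (A : pformula L n.+1) (r : fvar L -> term L)
    (s : 'I_n -> term L) t :
  inst_body (fsubst (fun v => tshift (r v)) (up s) A) t
  = fsubst r (scons t s) A.
Proof.
rewrite /inst_body fsubst_fsubst; apply: eq_fsubst => [v _|i].
  rewrite /tshift tsubst_tsubst -[RHS]tsubst_id; apply: eq_tsubst => // - [].
  by [].
rewrite /up /scons; case: unlift => //= j.
rewrite /tshift tsubst_tsubst -[RHS]tsubst_id; apply: eq_tsubst => // - [].
by [].
Qed.

Lemma fsubst_id (F : formula L) : fsubst FVar BVar F = F.
Proof.
suff gen m (G : pformula L m) s : s =1 BVar -> fsubst FVar s G = G.
  exact: gen.
elim: G s => {m} /=.
- move=> m p a s eq_s; congr Pred; apply/ffunP => i; rewrite !ffunE.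
  by rewrite -[RHS]tsubst_id; apply: eq_tsubst.
- move=> m t u s eq_s; congr Equ; rewrite -[RHS]tsubst_id; exact: eq_tsubst.
- by move=> m A IH s eq_s; rewrite IH.
- by move=> m A IHA B IHB s eq_s; rewrite IHA ?IHB.
- by move=> m A IHA B IHB s eq_s; rewrite IHA ?IHB.
- by move=> m A IHA B IHB s eq_s; rewrite IHA ?IHB.
- by move=> m A IH s eq_s; congr All; apply: IH => i; rewrite (eq_up eq_s) up_BVar.
- by move=> m A IH s eq_s; congr Ex; apply: IH => i; rewrite (eq_up eq_s) up_BVar.
Qed.

Lemma tocc_tsubst_fresh (t u : term L) v :
  ~~ tocc v t -> tsubst (fun w => if w == v then u else FVar w) BVar t = t.
Proof.
move=> v_t; rewrite -[RHS]tsubst_id; apply: eq_tsubst => // w w_t.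
by case: eqP w_t v_t => // -> ->.
Qed.

(** * Fresh variables and templates *)

Lemma tocc_finite n (t : pterm L n) :
  exists vs : seq (fvar L), forall v, tocc v t -> v \in vs.
Proof.
elim/pterm_nested_ind: t => [w|i|f a IH].
- by exists [:: w] => v /=; rewrite inE.
- by exists [::].
- have [vs vsP] := fin_all_exists IH.
  exists (flatten [seq vs i | i <- enum 'I_(fun_arity f)]) => v /existsP[i v_ai].
  by apply/flatten_mapP; exists i; [rewrite mem_enum | apply: vsP].
Qed.

Lemma focc_finite n (F : pformula L n) :
  exists vs : seq (fvar L), forall v, focc v F -> v \in vs.
Proof.
have join2 m (A B : pformula L m) :
    (exists vs : seq (fvar L), forall v, focc v A -> v \in vs) ->
    (exists vs : seq (fvar L), forall v, focc v B -> v \in vs) ->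
    exists vs : seq (fvar L), forall v, focc v A || focc v B -> v \in vs.
  move=> [vs vsP] [ws wsP]; exists (vs ++ ws) => v.
  by case/orP=> [/vsP|/wsP]; rewrite mem_cat => ->; rewrite ?orbT.
elim: F => {n} /=; do ?by [].
- move=> n p a.
  have [vs vsP] := fin_all_exists (fun i => tocc_finite (a i)).
  exists (flatten [seq vs i | i <- enum 'I_(pred_arity p)]) => v /existsP[i v_ai].
  by apply/flatten_mapP; exists i; [rewrite mem_enum | apply: vsP].
- move=> n t u; have [vs vsP] := tocc_finite t; have [ws wsP] := tocc_finite u.
  exists (vs ++ ws) => v.
  by case/orP=> [/vsP|/wsP]; rewrite mem_cat => ->; rewrite ?orbT.
- by move=> n A IHA B IHB; apply: join2.
- by move=> n A IHA B IHB; apply: join2.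
- by move=> n A IHA B IHB; apply: join2.
Qed.

Hypothesis fvar_infinite : forall vs : seq (fvar L), exists v, v \notin vs.

Lemma fresh_fvar (G : seq (formula L)) : exists v, ~~ has (focc v) G.
Proof.
suff [vs vsP] : exists vs : seq (fvar L), forall v, has (focc v) G -> v \in vs.
  by have [v v_vs] := fvar_infinite vs; exists v; apply: contra v_vs => /vsP.
elim: G => [|F G [vs vsP]]; first by exists [::].
have [ws wsP] := focc_finite F; exists (ws ++ vs) => v /=.
by case/orP=> [/wsP|/vsP]; rewrite mem_cat => ->; rewrite ?orbT.
Qed.

Lemma repl_repl_fresh (F : formula L) v w t :
  ~~ focc w F -> repl (repl F v (FVar w)) w t = repl F v t.
Proof.
move=> w_F; rewrite /repl fsubst_fsubst; apply: eq_fsubst => [z z_F|[//]].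
case: eqP => _ /=; first by rewrite eqxx.
by case: eqP z_F w_F => // -> ->.
Qed.

(** A context for a term.  Working with K instead of [repl F v] removes the
    freshness conditions of the equality rules, because the variable that marks
    the hole can always be renamed ([template_fresh]). *)
Definition template (K : term L -> formula L) : Prop :=
  exists F v, forall t, K t = repl F v t.

Lemma template_repl (F : formula L) v : template (repl F v).
Proof. by exists F, v. Qed.

Lemma template_fresh (K : term L -> formula L) (t u : term L) : template K ->
  exists F v, [/\ ~~ tocc v t, ~~ tocc v u & forall x, K x = repl F v x].
Proof.
move=> [F [v KE]]; have [w] := fresh_fvar [:: F; Equ t u].
rewrite /= !orbF !negb_or => /and3P[w_F w_t w_u].
by exists (repl F v (FVar w)), w; split=> // x; rewrite repl_repl_fresh.
Qed.

Definition upd n (T : Type) (a : {ffun 'I_n -> T}) i x : {ffun 'I_n -> T} :=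
  [ffun j => if j == i then x else a j].

Lemma template_Pred p (a : {ffun 'I_(pred_arity p) -> term L}) i :
  template (fun t => Pred p (upd a i t)).
Proof.
have [v] := fresh_fvar [:: Pred p a].
rewrite /= orbF negb_exists => /forallP v_a.
exists (Pred p (upd a i (FVar v))), v => t; congr Pred.
apply/ffunP => j; rewrite !ffunE; case: eqP => _ /=; first by rewrite eqxx.
by rewrite tocc_tsubst_fresh.
Qed.

Lemma template_Equ_l u : template (fun t => Equ t u).
Proof.
have [v] := fresh_fvar [:: Equ u u]; rewrite /= orbF orbb => v_u.
by exists (Equ (FVar v) u), v => t; rewrite /repl /= eqxx tocc_tsubst_fresh.
Qed.

Lemma template_Equ_r u : template (Equ u).
Proof.
have [v] := fresh_fvar [:: Equ u u]; rewrite /= orbF orbb => v_u.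
by exists (Equ u (FVar v)), v => t; rewrite /repl /= eqxx tocc_tsubst_fresh.
Qed.

(** This is what turns the rewriting of a subterm into an instance of the
    equality rules. *)
Lemma template_App K f (a : {ffun 'I_(fun_arity f) -> term L}) i :
  template K -> template (fun t => K (App f (upd a i t))).
Proof.
move=> [F [v KE]]; have [w] := fresh_fvar [:: F; Equ (App f a) (App f a)].
rewrite /= !orbF orbb negb_or => /andP[w_F]; rewrite negb_exists => /forallP w_a.
exists (repl F v (App f (upd a i (FVar w)))), w => t.
rewrite KE /repl fsubst_fsubst; apply: eq_fsubst => [z z_F|[//]].
case: eqP => _ /=; last by case: eqP z_F w_F => // -> ->.
congr App; apply/ffunP => j; rewrite !ffunE; case: eqP => _ /=.
  by rewrite eqxx.
by rewrite tocc_tsubst_fresh.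
Qed.

End Substitution.

Lemma updE n (T : Type) (a : {ffun 'I_n -> T}) i x : upd a i x i = x.
Proof. by rewrite ffunE eqxx. Qed.

Lemma upd_upd n (T : Type) (a : {ffun 'I_n -> T}) i x y :
  upd (upd a i x) i y = upd a i y.
Proof. by apply/ffunP => j; rewrite !ffunE; case: eqP. Qed.

Lemma upd_id n (T : Type) (a : {ffun 'I_n -> T}) i : upd a i (a i) = a.
Proof. by apply/ffunP => j; rewrite ffunE; case: eqP => // ->. Qed.

Lemma upd_comm n (T : Type) (a : {ffun 'I_n -> T}) i j x y : i != j ->
  upd (upd a i x) j y = upd (upd a j y) i x.
Proof.
move=> ne_ij; apply/ffunP => k; rewrite !ffunE.
by case: (k =P j) => // ->; rewrite eq_sym (negPf ne_ij).
Qed.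

(** A relation between tuples that holds entrywise can be applied one entry at
    a time. *)
Lemma ffun_stepwise n (T : Type) (J : T -> T -> Prop)
    (Q : {ffun 'I_n -> T} -> Prop) (a b : {ffun 'I_n -> T}) :
  (forall a i x y, J x y -> Q (upd a i x) -> Q (upd a i y)) ->
  (forall i, J (a i) (b i)) -> Q a -> Q b.
Proof.
move=> Qstep Jab Qa; pose mix k := [ffun i : 'I_n => if i < k then b i else a i].
suff mixP k : k <= n -> Q (mix k).
  have <- : mix n = b by apply/ffunP => i; rewrite ffunE ltn_ord.
  exact: mixP.
elim: k => [_|k IH lt_kn].
  by have -> : mix 0 = a by apply/ffunP => i; rewrite ffunE.
pose i := Ordinal lt_kn.
have -> : mix k.+1 = upd (mix k) i (b i).
  apply/ffunP => j; rewrite !ffunE; case: eqP => [->|/eqP ne_ji].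
    by rewrite ltnSn.
  by rewrite ltnS leq_eqVlt -[j == k :> nat]/(j == i) (negPf ne_ji).
apply: Qstep (Jab i) _.
have -> // : upd (mix k) i (a i) = mix k.
  by apply/ffunP => j; rewrite !ffunE; case: eqP => // ->; rewrite ltnn.
exact: IH (ltnW lt_kn).
Qed.

Lemma In_cat (T : Type) (x : T) (xs ys : seq T) :
  List.In x (xs ++ ys) <-> List.In x xs \/ List.In x ys.
Proof. exact: List.in_app_iff. Qed.

Definition all_in (T : Type) (P : T -> Prop) (xs : seq T) : Prop :=
  forall x, List.In x xs -> P x.

Lemma all_in_cat (T : Type) (P : T -> Prop) (xs ys : seq T) :
  all_in P (xs ++ ys) <-> all_in P xs /\ all_in P ys.
Proof.
split=> [Pxy|[Px Py] x /In_cat[/Px//|/Py//]].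
by split=> x x_in; apply: Pxy; apply/In_cat; [left | right].
Qed.

Lemma all_in1 (T : Type) (P : T -> Prop) (x : T) : all_in P [:: x] <-> P x.
Proof. by split=> [Px|Px y [<-|//]] //; apply: Px; left. Qed.

Lemma all_in2 (T : Type) (P : T -> Prop) (x y : T) :
  all_in P [:: x; y] <-> P x /\ P y.
Proof. by rewrite -[[:: x; y]]/([:: x] ++ [:: y]) all_in_cat !all_in1. Qed.

Lemma In_has (T : Type) (p : pred T) (xs : seq T) x :
  ~~ has p xs -> List.In x xs -> ~~ p x.
Proof.
elim: xs => //= y xs IH; rewrite negb_or => /andP[py pxs] [<-//|].
exact: IH.
Qed.

Lemma Permutation_In_last (T : Type) (x : T) (xs : seq T) :
  List.In x xs -> exists ys, Permutation.Permutation xs (ys ++ [:: x]).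
Proof.
elim: xs => // y xs IH [->|/IH[ys xs_ys]].
  by exists xs; apply: Permutation.Permutation_cons_append.
by exists (y :: ys); apply: Permutation.perm_skip.
Qed.

Definition join (L : language) (p q : sequent L) : sequent L :=
  antecedent p ++ antecedent q ⇒ succedent p ++ succedent q.

Definition sub_sequent (L : language) (p q : sequent L) : Prop :=
  List.incl (antecedent p) (antecedent q) /\ List.incl (succedent p) (succedent q).

(** The bound on succedents that makes LJ and LK one calculus: contexts will be
    the sequents with k = 0, derivable sequents have k = 1, and for LK nothing
    is demanded. *)
Definition narrow (L : language) (c : logic) k (q : sequent L) : Prop :=
  c = LJ -> size (succedent q) <= k.

Lemma restrictP (L : language) c (R : rule L) ps q :
  restrict c R ps q <-> R ps q /\ all_in (narrow c 1) (q :: ps).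
Proof.
case: c => /=; last by split=> [|[]].
split=> [] [Rpq nar]; split=> // p p_in; first by move=> _; apply: nar.
exact: nar.
Qed.

Ltac in_lists :=
  let x := fresh "x" in
  move=> x; rewrite /= ?In_cat /=; tauto.

Ltac sub_lists := split; rewrite /= ?cats0; in_lists.

Section Provability.
Variables (L : language) (c : logic) (R : rule L).
Hypothesis gentzen_R : forall ps q, gentzen_cut_free ps q -> R ps q.
Notation prov := (derivable (restrict c R)).
Notation narrow := (narrow c).

Lemma prov_narrow q : prov q -> narrow 1 q.
Proof. by case=> ps {}q /restrictP[_ nar] _; apply: nar; left. Qed.

Lemma prov_rule ps q : R ps q -> narrow 1 q -> all_in prov ps -> prov q.
Proof.
move=> Rpq q1 prov_ps; apply: (Infer _ prov_ps); apply/restrictP; split=> //.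
by move=> p [<-//|/prov_ps/prov_narrow].
Qed.

Lemma prov_structural p q : structural_rule [:: p] q -> narrow 1 q ->
  prov p -> prov q.
Proof.
move=> pq q1 prov_p; apply: (@prov_rule [:: p]) => //.
  by apply: gentzen_R; left; right.
by apply/all_in1.
Qed.

Lemma prov_logical ps q : logical_rule ps q -> narrow 1 q ->
  all_in prov ps -> prov q.
Proof. by move=> pq; apply: prov_rule; apply: gentzen_R; right. Qed.

Lemma prov_axiom F : prov ([:: F] ⇒ [:: F]).
Proof.
apply: (@prov_rule [::]) => //.
by apply: gentzen_R; left; left.
Qed.

Lemma prov_permL G G' D : Permutation.Permutation G G' ->
  prov (G ⇒ D) -> prov (G' ⇒ D).
Proof.
move=> GG'; suff gen G0 : prov (G0 ++ G ⇒ D) -> prov (G0 ++ G' ⇒ D).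
  exact: (gen [::]).
elim: {G G'}GG' G0 => //.
- by move=> F G G' _ IH G0; rewrite -!cat_rcons; apply: IH.
- move=> A B G G0 H; apply: (prov_structural (ExchL _ _ _ _ _) _ H).
  exact: (prov_narrow H).
- by move=> G1 G2 G3 _ IH12 _ IH23 G0 /IH12; apply: IH23.
Qed.

Lemma prov_permR D D' G : c = LK -> Permutation.Permutation D D' ->
  prov (G ⇒ D) -> prov (G ⇒ D').
Proof.
move=> cK DD'; suff gen D0 : prov (G ⇒ D0 ++ D) -> prov (G ⇒ D0 ++ D').
  exact: (gen [::]).
elim: {D D'}DD' D0 => //.
- by move=> F D D' _ IH D0; rewrite -!cat_rcons; apply: IH.
- move=> A B D D0 H; apply: (prov_structural (ExchR _ _ _ _ _) _ H).
  by rewrite cK.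
- by move=> D1 D2 D3 _ IH12 _ IH23 D0 /IH12; apply: IH23.
Qed.

Lemma prov_inclL G G' D : List.incl G G' -> prov (G ⇒ D) -> prov (G' ⇒ D).
Proof.
move=> GG' GD; have nar G0 : narrow 1 (G0 ⇒ D) by have := prov_narrow GD.
have: prov (G' ++ G ⇒ D).
  apply: prov_permL (Permutation.Permutation_app_comm _ _) _.
  elim: G' G GD {GG'} => [|F G' IH] G GD.
    by rewrite -[(G ++ [::])%list]/(G ++ [::]) cats0.
  rewrite -[(_ ++ _)%list]/(G ++ F :: G') -cat_rcons -cats1; apply: IH.
  exact: (prov_structural (WeakL _ _ _) _ GD).
move: GG'; clear GD; elim/last_ind: G => [|G F IH] GG'; first by rewrite cats0.
have [G3 perm] : exists G3, Permutation.Permutation (G' ++ G) (G3 ++ [:: F]).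
  apply: Permutation_In_last; rewrite In_cat; left; apply: GG'.
  by rewrite -cats1 In_cat; right; left.
rewrite -cats1 catA => H; apply: IH.
  by move=> x x_G; apply: GG'; rewrite -cats1 In_cat; left.
apply: prov_permL (Permutation.Permutation_sym perm) _.
apply: prov_structural (ContrL _ _ _) _ _ => //.
rewrite -[[:: F; F]]/([:: F] ++ [:: F]) catA.
by apply: prov_permL H; apply: Permutation.Permutation_app_tail.
Qed.

Lemma prov_inclR D D' G : narrow 1 (G ⇒ D') -> List.incl D D' ->
  prov (G ⇒ D) -> prov (G ⇒ D').
Proof.
move=> D'1 DD' GD; have D1 := prov_narrow GD.
have [cE|cE] : c = LK \/ c = LJ by case: (c); [right | left].
  have nar q : narrow 1 q by move=> cJ; rewrite cJ in cE.
  have: prov (G ⇒ D' ++ D).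
    apply: prov_permR (Permutation.Permutation_app_comm _ _) _ => //.
    elim: D' D GD {DD' D1 D'1} => [|F D' IH] D GD.
      by rewrite -[(D ++ [::])%list]/(D ++ [::]) cats0.
    rewrite -[(_ ++ _)%list]/(D ++ F :: D') -cat_rcons -cats1; apply: IH.
    exact: (prov_structural (WeakR _ _ _) _ GD).
  move: DD'; clear D1 GD; elim/last_ind: D => [|D F IH] DD'; first by rewrite cats0.
  have [D3 perm] : exists D3, Permutation.Permutation (D' ++ D) (D3 ++ [:: F]).
    apply: Permutation_In_last; rewrite In_cat; left; apply: DD'.
    by rewrite -cats1 In_cat; right; left.
  rewrite -cats1 catA => H; apply: IH.
    by move=> x x_D; apply: DD'; rewrite -cats1 In_cat; left.
  apply: prov_permR (Permutation.Permutation_sym perm) _ => //.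
  apply: prov_structural (ContrR _ _ _) _ _ => //.
  rewrite -[[:: F; F]]/([:: F] ++ [:: F]) catA.
  by apply: prov_permR H => //; apply: Permutation.Permutation_app_tail.
move: (D'1 cE) (D1 cE) => /=; case: D DD' GD {D1} => [|A [|//]] DD' GD.
  case: D' D'1 {DD'} => [//|B [|//]] D'1 _ _.
  by rewrite -[[:: B]]/([::] ++ [:: B]); apply: (prov_structural (WeakR _ _ _) _ GD).
have: List.In A D' by apply: DD'; left.
by case: D' {DD' D'1} => [|B [|? ?]] //= B_A // _ _; case: B_A => [->|[]].
Qed.

(** The structural rules together say that provability depends only on the sets
    of formulae on the two sides, and is monotone in them. *)
Lemma prov_sub p q : prov p -> sub_sequent p q -> narrow 1 q -> prov q.
Proof.
case: p => G D; case: q => G' D' GD [/= GG' DD'] q1.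
by apply: prov_inclR DD' _ => //; apply: prov_inclL GD.
Qed.

End Provability.

(** * Equational consequence *)

Inductive eqv (L : language) (G : seq (formula L)) : term L -> term L -> Prop :=
| eqv_base t u : List.In (Equ t u) G -> eqv G t u
| eqv_refl t : eqv G t t
| eqv_sym t u : eqv G t u -> eqv G u t
| eqv_trans t u x : eqv G t u -> eqv G u x -> eqv G t x
| eqv_App f (a b : {ffun 'I_(fun_arity f) -> term L}) :
    (forall i, eqv G (a i) (b i)) -> eqv G (App f a) (App f b).

Lemma eqv_incl (L : language) (G G' : seq (formula L)) t u :
  List.incl G G' -> eqv G t u -> eqv G' t u.
Proof.
move=> GG'; elim=> {t u}.
- by move=> t u /GG'; apply: eqv_base.
- exact: eqv_refl.
- by move=> t u _; apply: eqv_sym.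
- by move=> t u x _ tu _; apply: eqv_trans tu.
- by move=> f a b _; apply: eqv_App.
Qed.

Lemma eqv_tsubst (L : language) (G : seq (formula L)) n
    (r r' : fvar L -> term L) (s s' : 'I_n -> term L) t :
  (forall v, eqv G (r v) (r' v)) -> (forall i, eqv G (s i) (s' i)) ->
  eqv G (tsubst r s t) (tsubst r' s' t).
Proof.
move=> rr' ss'; elim/pterm_nested_ind: t => //= f a IH.
by apply: eqv_App => i; rewrite !ffunE.
Qed.

(** The sequents that a cut-free calculus must derive by itself: the instances
    of replacement of equals in atomic formulae.  Logically complex formulae are
    taken care of by the model. *)
Definition equational (L : language) (c : logic) (R : rule L) : Prop :=
  (forall G t u, eqv G t u -> derivable (restrict c R) (G ⇒ [:: Equ t u])) /\
  (forall G p (a b : {ffun 'I_(pred_arity p) -> term L}),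
     List.In (Pred p b) G -> (forall i, eqv G (a i) (b i)) ->
     derivable (restrict c R) (G ⇒ [:: Pred p a])).

(** * The model *)

Section Model.
Variables (L : language) (c : logic) (R : rule L).
Hypothesis fvar_infinite : forall vs : seq (fvar L), exists v, v \notin vs.
Hypothesis gentzen_R : forall ps q, gentzen_cut_free ps q -> R ps q.
Notation prov := (derivable (restrict c R)).
Notation narrow := (narrow c).
Hypothesis R_equational : equational c R.

(** Contexts m are sequents with [narrow 0 m], tests n are sequents with
    [narrow 1 n].  For LJ a context is thus an antecedent and a test may have
    one formula in the succedent; for LK contexts and tests are arbitrary
    sequents.  The join of a context and a test is a sequent of the calculus in
    both cases, which is why one model serves both logics. *)

Ltac narrow_sizes :=
  let cJ := fresh "cJ" in
  move=> cJ;
  repeat match goal with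
  | H : narrow _ _ |- _ => move: (H cJ); clear H
  end;
  rewrite /= ?size_cat /=; lia.

Ltac weaken H :=
  apply: (prov_sub gentzen_R H); [sub_lists | try narrow_sizes].

Ltac conclude H :=
  let H1 := fresh H in
  have H1 := H ltac:(narrow_sizes); weaken H1.

Definition orth (X : sequent L -> Prop) (n : sequent L) : Prop :=
  forall m, narrow 0 m -> X m -> prov (join m n).

(** Biorthogonal closure: m passes all the tests passed by X.  Monotonicity and
    contraction of provability make the closed sets a Heyting algebra whose
    meet is intersection. *)
Definition closure (X : sequent L -> Prop) (m : sequent L) : Prop :=
  narrow 0 m /\ forall n, narrow 1 n -> orth X n -> prov (join m n).

Definition refutes (X : sequent L -> Prop) (m : sequent L) : Prop :=
  forall m' n, narrow 0 m' -> X m' -> narrow 1 n -> prov (join m (join m' n)).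

(** Free variables and dangling indices range over the terms themselves, so that
    quantifiers are intersections and closed unions over all terms.  An atomic
    formula holds, before closure, in the contexts that contain it up to
    provable equality of its arguments. *)
Fixpoint sem n (F : pformula L n) (r : fvar L -> term L) :
    ('I_n -> term L) -> sequent L -> Prop :=
  match F in pformula _ n return ('I_n -> term L) -> sequent L -> Prop with
  | Pred _ p a => fun s => closure (fun m =>
      exists2 b, List.In (Pred p b) (antecedent m) &
        forall i, eqv (antecedent m) (tsubst r s (a i)) (b i))
  | Equ _ t u => fun s => closure (fun m =>
      eqv (antecedent m) (tsubst r s t) (tsubst r s u))
  | Neg _ A => fun s m => narrow 0 m /\ refutes (sem A r s) m
  | And _ A B => fun s m => sem A r s m /\ sem B r s m
  | Or _ A B => fun s => closure (fun m => sem A r s m \/ sem B r s m)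
  | Imp _ A B => fun s m => narrow 0 m /\
      forall m', narrow 0 m' -> sem A r s m' -> sem B r s (join m m')
  | All _ A => fun s m => narrow 0 m /\ forall t, sem A r (scons t s) m
  | Ex _ A => fun s => closure (fun m => exists t, sem A r (scons t s) m)
  end.

Lemma sem_narrow n (F : pformula L n) r s m : sem F r s m -> narrow 0 m.
Proof.
elim: F s => {n} /= [n p a|n t u|n A _|n A IHA B _|n A _ B _|n A _ B _|n A _|n A _];
  move=> s; try by case.
by case=> /IHA.
Qed.

Lemma closure_id (X : sequent L -> Prop) m : narrow 0 m -> X m -> closure X m.
Proof. by move=> m0 Xm; split=> // n n1; apply. Qed.

Lemma orth_sub (X Y : sequent L -> Prop) n :
  (forall m, narrow 0 m -> X m -> Y m) -> orth Y n -> orth X n.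
Proof. by move=> XY Yn m m0 /(XY m m0); apply: Yn. Qed.

Lemma closure_sub (X Y : sequent L -> Prop) m :
  (forall m', narrow 0 m' -> X m' -> Y m') -> closure X m -> closure Y m.
Proof. by move=> XY [m0 Xm]; split=> // n n1 /(orth_sub XY); apply: Xm. Qed.

Lemma closure_idem (X : sequent L -> Prop) m :
  closure (closure X) m -> closure X m.
Proof. by move=> [m0 Xm]; split=> // n n1 Xn; apply: Xm => // m' m'0 [_]; apply. Qed.

Lemma closure_iff (X Y : sequent L -> Prop) m :
  (forall m', X m' <-> Y m') -> closure X m <-> closure Y m.
Proof. by move=> XY; split; apply: closure_sub => m' _ /XY. Qed.

Lemma orth_join (X : sequent L -> Prop) m n :
  narrow 0 m -> narrow 1 n -> orth X n -> orth X (join m n).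
Proof. by move=> m0 n1 Xn m' m'0 /(Xn m' m'0) H; weaken H. Qed.

(** Closedness passes from B to A → B because a test of B after a context of A
    is again a test. *)
Lemma sem_closed n (F : pformula L n) r s m :
  closure (sem F r s) m -> sem F r s m.
Proof.
elim: F s m => {n} /=.
- by move=> n p a s m; apply: closure_idem.
- by move=> n t u s m; apply: closure_idem.
- move=> n A IH s m [m0 Fm]; split=> // m' n' m'0 Am' n'1.
  apply: Fm => [|m1 m10 [_ m1A]]; first by narrow_sizes.
  exact: m1A.
- move=> n A IHA B IHB s m Fm; split; [apply: IHA|apply: IHB];
  by apply: closure_sub Fm => m' _ [].
- by move=> n A _ B _ s m; apply: closure_idem.
- move=> n A IHA B IHB s m [m0 Fm]; split=> // m' m'0 Am'.
  apply: IHB; split=> [|n' n'1 Bn']; first by narrow_sizes.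
  suff H : prov (join m (join m' n')) by weaken H.
  apply: Fm => [|m1 m10 [_ m1AB]]; first by narrow_sizes.
  have H : prov (join (join m1 m') n') by apply: Bn'; [narrow_sizes|apply: m1AB].
  by weaken H.
- move=> n A IH s m Fm; split=> [|t]; first by case: Fm.
  by apply: IH; apply: closure_sub Fm => m' _ [].
- by move=> n A _ s m; apply: closure_idem.
Qed.

Lemma sem_sub n (F : pformula L n) r s m m' :
  sem F r s m -> sub_sequent m m' -> narrow 0 m' -> sem F r s m'.
Proof.
move=> Fm [mm'1 mm'2] m'0; have m0 := sem_narrow Fm.
apply: sem_closed; split=> // n' n'1 Fn'; have H := Fn' m m0 Fm.
apply: (prov_sub gentzen_R H); last by narrow_sizes.
by split; apply: List.incl_app_app.
Qed.

Lemma sem_joinl n (F : pformula L n) r s m m' :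
  sem F r s m -> narrow 0 m' -> sem F r s (join m m').
Proof.
move=> Fm m'0; have m0 := sem_narrow Fm; apply: sem_sub Fm _ _.
  by sub_lists.
by narrow_sizes.
Qed.

Lemma sem_joinr n (F : pformula L n) r s m m' :
  sem F r s m -> narrow 0 m' -> sem F r s (join m' m).
Proof.
move=> Fm m'0; have m0 := sem_narrow Fm; apply: sem_sub Fm _ _.
  by sub_lists.
by narrow_sizes.
Qed.

Lemma scons_tsubst n p (r' : fvar L -> pterm L p) (s : 'I_n -> pterm L p) t
    (s' : 'I_p -> term L) (r : fvar L -> term L) :
  (fun i => tsubst r (scons t s') (up s i))
  = scons t (fun i => tsubst r s' (s i)).
Proof.
apply: functional_extensionality => i; rewrite /up /scons.
case: unlift => [j|] /=; last by rewrite unlift_none.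
exact: tsubst_scons_tshift.
Qed.

Lemma sem_fsubst n p (F : pformula L n) (r : fvar L -> pterm L p)
    (s : 'I_n -> pterm L p) r' s' m :
  sem (fsubst r s F) r' s' m
  <-> sem F (fun v => tsubst r' s' (r v)) (fun i => tsubst r' s' (s i)) m.
Proof.
have shift_r k (r1 : fvar L -> pterm L k) (s1 : 'I_k -> term L) t :
    (fun v => tsubst r' (scons t s1) (tshift (r1 v)))
    = (fun v => tsubst r' s1 (r1 v)).
  by apply: functional_extensionality => v; apply: tsubst_scons_tshift.
elim: F p r s s' m => {n} /=.
- move=> n q a p r s s' m; apply: closure_iff => m'; split=> - [b b_in ab];
  by exists b => // i; move: (ab i); rewrite ffunE tsubst_tsubst.
- by move=> n t u p r s s' m; rewrite !tsubst_tsubst.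
- move=> n A IH p r s s' m; split=> - [m0 Am]; split=> // m' n' m'0 /IH;
  exact: Am.
- move=> n A IHA B IHB p r s s' m.
  by split=> - [Am Bm]; split; [apply/IHA|apply/IHB|apply/IHA|apply/IHB].
- move=> n A IHA B IHB p r s s' m; apply: closure_iff => m'.
  by split=> - [Am|Bm]; [left; apply/IHA | right; apply/IHB
                        |left; apply/IHA | right; apply/IHB].
- move=> n A IHA B IHB p r s s' m; split=> - [m0 ABm]; split=> // m' m'0 /IHA Am';
  by apply/IHB; apply: ABm.
- move=> n A IH p r s s' m; split=> - [m0 Am]; split=> // t;
  by move/IH: (Am t) || apply/IH; rewrite shift_r scons_tsubst.
- move=> n A IH p r s s' m; apply: closure_iff => m'.
  by split=> - [t Am']; exists t; move: Am'; rewrite IH shift_r scons_tsubst.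
Qed.

Lemma sem_eq_fvar n (F : pformula L n) r r' s m :
  (forall v, focc v F -> r v = r' v) -> sem F r s m <-> sem F r' s m.
Proof.
elim: F s m => {n} /=.
- move=> n p a s m rr'.
  suff eq_a i : tsubst r s (a i) = tsubst r' s (a i).
    by apply: closure_iff => m'; split=> - [b b_in ab]; exists b => // i;
       [rewrite -eq_a|rewrite eq_a].
  by apply: eq_tsubst => // v v_a; apply: rr'; apply/existsP; exists i.
- move=> n t u s m rr'.
  rewrite (@eq_tsubst _ _ _ r r' s s t) //; last by move=> v v_t; rewrite rr' ?v_t.
  by rewrite (@eq_tsubst _ _ _ r r' s s u) // => v v_u; rewrite rr' ?v_u ?orbT.
- move=> n A IH s m rr'; split=> - [m0 Am]; split=> // m' n' m'0;
  by move/(IH _ _ rr'); apply: Am.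
- move=> n A IHA B IHB s m rr'.
  have {}IHA := IHA _ _ (fun v v_A => rr' v (introT orP (or_introl v_A))).
  have {}IHB := IHB _ _ (fun v v_B => rr' v (introT orP (or_intror v_B))).
  by split=> - [Am Bm]; split; [apply/IHA|apply/IHB|apply/IHA|apply/IHB].
- move=> n A IHA B IHB s m rr'.
  have {}IHA := IHA _ _ (fun v v_A => rr' v (introT orP (or_introl v_A))).
  have {}IHB := IHB _ _ (fun v v_B => rr' v (introT orP (or_intror v_B))).
  apply: closure_iff => m'.
  by split=> - [Am|Bm]; [left; apply/IHA | right; apply/IHB
                        |left; apply/IHA | right; apply/IHB].
- move=> n A IHA B IHB s m rr'.
  have {}IHA := IHA _ _ (fun v v_A => rr' v (introT orP (or_introl v_A))).
  have {}IHB := IHB _ _ (fun v v_B => rr' v (introT orP (or_intror v_B))).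
  split=> - [m0 ABm]; split=> // m' m'0 /IHA Am';
  by apply/IHB; apply: ABm.
- move=> n A IH s m rr'; split=> - [m0 Am]; split=> // t;
  by apply/(IH _ _ rr'); apply: Am.
- move=> n A IH s m rr'; apply: closure_iff => m'.
  by split=> - [t Am']; exists t; apply/(IH _ _ rr').
Qed.

Lemma sem_fresh n (F : pformula L n) r v t s m : ~~ focc v F ->
  sem F r s m <-> sem F (fun w => if w == v then t else r w) s m.
Proof.
move=> v_F; apply: sem_eq_fvar => w w_F.
by case: eqP w_F v_F => // -> ->.
Qed.

(** ** Equality in the model *)

(** At a context whose equations identify two environments these give every
    formula the same value.  Implication and negation use the hypothesis at
    larger contexts, and in both directions: hence the general induction
    statement. *)
Lemma sem_eqv n (F : pformula L n) r r' s s' m :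
  (forall v, eqv (antecedent m) (r v) (r' v)) ->
  (forall i, eqv (antecedent m) (s i) (s' i)) ->
  sem F r s m -> sem F r' s' m.
Proof.
have eqv_joinr (m1 m2 : sequent L) t u :
    eqv (antecedent m2) t u -> eqv (antecedent (join m1 m2)) t u.
  by apply: eqv_incl; in_lists.
have eqv_joinl (m1 m2 : sequent L) t u :
    eqv (antecedent m1) t u -> eqv (antecedent (join m1 m2)) t u.
  by apply: eqv_incl; in_lists.
(* For closures it suffices to compare X and Y after adding m1 to the context,
   because the second copy of m1 can be contracted. *)
have closure_shift (X Y : sequent L -> Prop) m1 :
    (narrow 0 m1 -> forall m', narrow 0 m' -> X m' -> Y (join m' m1)) ->
    closure X m1 -> closure Y m1.
  move=> XY [m10 Xm1]; split=> // n' n'1 Yn'.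
  suff H : prov (join m1 (join m1 n')) by weaken H.
  apply: Xm1 => [|m' m'0 Xm']; first by narrow_sizes.
  have H : prov (join (join m' m1) n') by apply: Yn'; [narrow_sizes|apply: XY].
  by weaken H.
elim: F r r' s s' m => {n} /=.
- move=> n p a r r' s s' m rr' ss'; apply: closure_shift => m0 m' _ [b b_in ab].
  exists b => [|i]; first by rewrite In_cat; left.
  have aa' := eqv_joinr m' _ _ _ (eqv_tsubst (a i) rr' ss').
  exact: eqv_trans (eqv_sym aa') (eqv_joinl _ _ _ _ (ab i)).
- move=> n t u r r' s s' m rr' ss'; apply: closure_shift => m0 m' _ tu.
  have tt' := eqv_joinr m' _ _ _ (eqv_tsubst t rr' ss').
  have uu' := eqv_joinr m' _ _ _ (eqv_tsubst u rr' ss').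
  exact: eqv_trans (eqv_sym tt') (eqv_trans (eqv_joinl _ _ _ _ tu) uu').
- move=> n A IH r r' s s' m rr' ss' [m0 Am]; split=> // m' n' m'0 Am' n'1.
  suff H : prov (join m (join (join m m') n')) by weaken H.
  apply: Am => //; first by narrow_sizes.
  apply: (IH r' _ s'); [move=> v|move=> i|exact: sem_joinr];
  by apply: eqv_joinl; apply: eqv_sym.
- move=> n A IHA B IHB r r' s s' m rr' ss' [Am Bm].
  by split; [apply: IHA Am|apply: IHB Bm].
- move=> n A IHA B IHB r r' s s' m rr' ss'; apply: closure_shift => m0 m' m'0.
  by case=> Xm'; [left; apply: (IHA r _ s)|right; apply: (IHB r _ s)];
     do ?[exact: sem_joinl|move=> v; apply: eqv_joinr].
- move=> n A IHA B IHB r r' s s' m rr' ss' [m0 ABm]; split=> // m' m'0 Am'.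
  apply: sem_sub (_ : sem B r' s' (join m (join m m'))) _ _;
    [|by sub_lists|by narrow_sizes].
  apply: (IHB r _ s); try by move=> v; apply: eqv_joinl.
  apply: ABm; first by narrow_sizes.
  by apply: (IHA r' _ s'); [move=> v|move=> v|exact: sem_joinr];
     apply: eqv_joinl; apply: eqv_sym.
- move=> n A IH r r' s s' m rr' ss' [m0 Am]; split=> // t.
  apply: IH (Am t) => // i; rewrite /scons; case: unlift => //.
  exact: eqv_refl.
- move=> n A IH r r' s s' m rr' ss'; apply: closure_shift => m0 m' m'0 [t Am'].
  exists t; apply: (IH r _ (scons t s)) (sem_joinl Am' m0) => [v|i].
    exact: eqv_joinr.
  rewrite /scons; case: unlift => [j|]; last exact: eqv_refl.
  exact: eqv_joinr.
Qed.

Notation sat r m A := (sem A r (@BVar L 0) m).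

Lemma sat_Equ_sym r t u m : sat r m (Equ t u) -> sat r m (Equ u t).
Proof. by apply: closure_sub => m' _; apply: eqv_sym. Qed.

Lemma sat_Equ_refl r t m : narrow 0 m -> sat r m (Equ t t).
Proof. by move=> m0; apply: closure_id => //; apply: eqv_refl. Qed.

(** The equation holds at m only up to closure: m need not contain equations that
    entail it.  So the replacement is made at the contexts m' that do, joined
    to m, and then transported back by the closure property of F. *)
Lemma sat_repl r t u m F v : sat r m (Equ t u) ->
  sat r m (repl F v t) -> sat r m (repl F v u).
Proof.
move=> [m0 tu] Ft; apply: sem_closed; split=> // n n1 Fun.
suff H : prov (join m (join m n)) by weaken H.
apply: tu => [|m' m'0 tu]; first by narrow_sizes.
have H : prov (join (join m' m) n); last by weaken H.
apply: Fun; first by narrow_sizes.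
have := sem_joinr Ft m'0; rewrite /repl !sem_fsubst; apply: sem_eqv => [w|[//]].
case: eqP => _; last exact: eqv_refl.
by apply: eqv_incl tu; in_lists.
Qed.

Lemma sat_inst_body r m (A : pformula L 1) t :
  sat r m (inst_body A t) <-> sem A r (scons (tsubst r BVar t) BVar) m.
Proof.
rewrite /inst_body sem_fsubst.
have -> // : (fun=> tsubst r (@BVar L 0) t) = scons (tsubst r BVar t) BVar.
by apply: functional_extensionality => i; rewrite /scons; case: unliftP => [[]|].
Qed.

(** ** Soundness *)

(** One m serves all the antecedents and one n all the succedents.  This is
    harmless by contraction, makes the structural rules trivially sound, and
    fits LJ, where two tests cannot be joined. *)
Definition valid r (q : sequent L) : Prop :=
  forall m n, narrow 0 m -> narrow 1 n ->
    all_in (fun A => sat r m A) (antecedent q) ->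
    all_in (fun A => orth (fun m' => sat r m' A) n) (succedent q) ->
    prov (join m n).

Definition sound (R' : rule L) : Prop :=
  forall ps q, R' ps q -> all_in (narrow 1) (q :: ps) ->
    all_in (fun p => forall r, valid r p) ps -> forall r, valid r q.

Lemma all_in_sub (T : Type) (P Q : T -> Prop) xs :
  (forall x, P x -> Q x) -> all_in P xs -> all_in Q xs.
Proof. by move=> PQ Pxs x /Pxs/PQ. Qed.

Lemma all_orth_join r m n D : narrow 0 m -> narrow 1 n ->
  all_in (fun A => orth (fun m' => sat r m' A) n) D ->
  all_in (fun A => orth (fun m' => sat r m' A) (join m n)) D.
Proof. by move=> m0 n1; apply: all_in_sub => A; apply: orth_join. Qed.

Lemma all_sat_joinr r m m' G : narrow 0 m' ->
  all_in (fun A => sat r m A) G -> all_in (fun A => sat r (join m' m) A) G.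
Proof. by move=> m'0; apply: all_in_sub => A /sem_joinr; apply. Qed.

Lemma all_sat_joinl r m m' G : narrow 0 m' ->
  all_in (fun A => sat r m A) G -> all_in (fun A => sat r (join m m') A) G.
Proof. by move=> m'0; apply: all_in_sub => A /sem_joinl; apply. Qed.

(** For a succedent formula B validity means membership in [B] at the contexts
    that refute the remaining succedent D.  This is the one place where the two
    logics differ: in LJ there is no D, and in LK the test is itself a context,
    which can be joined to m. *)
Lemma valid_succedent_last r G D B : narrow 1 (G ⇒ D ++ [:: B]) ->
  valid r (G ⇒ D ++ [:: B])
  <-> forall m, narrow 0 m -> all_in (fun A => sat r m A) G ->
        all_in (fun A => refutes (fun m' => sat r m' A) m) D -> sat r m B.
Proof.
move=> DB1; split=> [val m m0 mG mD|val m n m0 n1 /= mG].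
  apply: sem_closed; split=> // n n1 Bn.
  suff H : prov (join m (join m n)) by weaken H.
  apply: val => //=; first by narrow_sizes.
  apply/all_in_cat; split; last by apply/all_in1; apply: orth_join.
  by move=> A /mD mA m' m'0 Am'; have H := mA m' n m'0 Am' n1; weaken H.
case/all_in_cat=> Dn /all_in1 Bn.
have [cK|cJ] : c = LK \/ c = LJ by case: (c); [right | left].
  have narK k q : narrow k q by rewrite cK.
  suff H : prov (join (join m n) n) by weaken H.
  apply: Bn => //; apply: val => //; first exact: all_sat_joinl.
  move=> A /Dn An m' n' m'0 Am' _.
  by have H := An m' m'0 Am'; weaken H.
have D0 : D = [::] by apply/nilP; move: (DB1 cJ); rewrite /= size_cat addn1 ltnS leqn0.
by apply: Bn => //; apply: val => //; rewrite D0.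
Qed.

Lemma sound_structural : sound (@structural_rule L).
Proof.
move=> ps q rul _ IH r m n m0 n1.
case: rul IH => [G D F|G D F|G G' D A B|G D D' A B|G D F|G D F] /all_in1 IH /= mG nD;
apply: (IH r m n m0 n1) => /= A' A'_in; do ?[exact: mG|exact: nD];
(apply: mG || apply: nD); move: A'_in; rewrite !In_cat /= ?In_cat /=; tauto.
Qed.

Lemma sound_axiom : sound (@logical_axiom L).
Proof. by move=> ps q [F] _ _ r m n m0 n1 /all_in1 mF /all_in1; apply. Qed.

Lemma sound_refl : sound (@reflexivity_axiom L).
Proof.
by move=> ps q [t] _ _ r m n m0 n1 _ /all_in1; apply => //; apply: sat_Equ_refl.
Qed.

(** Every context of the cut formula, joined to m, passes the test n by the
    right premise; so m joined to n is a test of the cut formula, and the left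
    premise applies. *)
Lemma sound_cut : sound (@cut_rule L).
Proof.
move=> ps q [G D G' D' F] _ /all_in2[IH IH'] r m n m0 n1 /=.
case/all_in_cat=> mG mG' /all_in_cat[nD nD'].
have mn1 : narrow 1 (join m n) by narrow_sizes.
suff H : prov (join m (join m n)) by weaken H.
apply: (IH r) => //=; apply/all_in_cat; split; first exact: all_orth_join.
apply/all_in1 => m' m'0 Fm'.
have H : prov (join (join m' m) n); last by weaken H.
apply: (IH' r) => //=; first by narrow_sizes.
apply/all_in_cat; split; first exact: all_sat_joinr.
by apply/all_in1; apply: sem_joinl.
Qed.

Lemma sound_congruence : sound (@congruence_rule L).
Proof.
move=> ps q [G D G' D' F v t u _ _] _ /all_in2[IH IH'] r m n m0 n1 /=.
case/all_in_cat=> mG /all_in_cat[mG' /all_in1 tu] /all_in_cat[nD nD'].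
have mn1 : narrow 1 (join m n) by narrow_sizes.
suff H : prov (join m (join m n)) by weaken H.
apply: (IH r) => //=; apply/all_in_cat; split; first exact: all_orth_join.
apply/all_in1 => m' m'0 Fm'.
have H : prov (join (join m' m) n); last by weaken H.
apply: (IH' r) => //=; first by narrow_sizes.
apply/all_in_cat; split; first exact: all_sat_joinr.
apply/all_in1; apply: sat_repl (sem_joinr tu m'0) _.
exact: sem_joinl.
Qed.

Lemma sound_eq_rules (S : pred eq_name) : sound (eq_rules S).
Proof.
have right r G D F v t u m n : valid r (G ⇒ D ++ [:: repl F v t]) ->
    narrow 0 m -> narrow 1 n -> sat r m (Equ t u) ->
    all_in (fun A => sat r m A) G ->
    all_in (fun A => orth (fun m' => sat r m' A) n) (D ++ [:: repl F v u]) ->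
    prov (join m n).
  move=> IH m0 n1 tu mG /all_in_cat[nD /all_in1 Fun].
  have mn1 : narrow 1 (join m n) by narrow_sizes.
  suff H : prov (join m (join m n)) by weaken H.
  apply: IH => //=; apply/all_in_cat; split; first exact: all_orth_join.
  apply/all_in1 => m' m'0 Fm'.
  have H : prov (join (join m' m) n); last by weaken H.
  apply: Fun; first by narrow_sizes.
  by apply: sat_repl (sem_joinr tu m'0) _; apply: sem_joinl.
have left r G D F v t u m n : valid r (G ++ [:: repl F v t] ⇒ D) ->
    narrow 0 m -> narrow 1 n -> sat r m (Equ u t) ->
    all_in (fun A => sat r m A) G -> sat r m (repl F v u) ->
    all_in (fun A => orth (fun m' => sat r m' A) n) D ->
    prov (join m n).
  move=> IH m0 n1 ut mG Fu nD; apply: IH => //=.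
  by apply/all_in_cat; split=> //; apply/all_in1; apply: sat_repl Fu.
move=> ps q [e _ rul] _; case: rul => {e} G D F v t u _ _ /all_in1 IH r m n m0 n1 /=.
- by case/all_in_cat=> mG /all_in1 tu; apply: right tu mG.
- by case/all_in_cat=> mG /all_in1/sat_Equ_sym tu; apply: right tu mG.
- case/all_in_cat=> mG /all_in2[Fu /sat_Equ_sym ut] nD.
  exact: left (IH r) m0 n1 ut mG Fu nD.
- case/all_in_cat=> mG /all_in2[Fu ut] nD.
  exact: left (IH r) m0 n1 ut mG Fu nD.
Qed.

Lemma sound_logical : sound (@logical_rule L).
Proof.
move=> ps q /= rul nar IH r.
have {nar} [q1 ps1] : narrow 1 q /\ all_in (narrow 1) ps.
  by move/(all_in_cat _ [:: q]): nar => [/all_in1].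
case: rul q1 ps1 IH.
- move=> G D A _ _ /all_in1 IH m n m0 n1 /= /all_in_cat[mG /all_in1[_ mA]] nD.
  have mn1 : narrow 1 (join m n) by narrow_sizes.
  suff H : prov (join m (join m n)) by weaken H.
  apply: (IH r) => //=; apply/all_in_cat; split; first exact: all_orth_join.
  by apply/all_in1 => m' m'0 Am'; have H := mA m' n m'0 Am' n1; weaken H.
- move=> G D A q1 _ /all_in1 IH; apply/valid_succedent_last => // m m0 mG mD.
  split=> // m' n m'0 Am' n1.
  suff H : prov (join (join m m') (join m n)) by weaken H.
  apply: (IH r) => //=; do ?by narrow_sizes.
    apply/all_in_cat; split; first exact: all_sat_joinl.
    by apply/all_in1; apply: sem_joinr.
  move=> B /mD mB m1 m10 Bm1.
  by have H := mB m1 n m10 Bm1 n1; weaken H.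
- move=> G D A B _ _ /all_in1 IH m n m0 n1 /= /all_in_cat[mG /all_in1[mA _]] nD.
  by apply: (IH r) => //=; apply/all_in_cat; split=> //; apply/all_in1.
- move=> G D A B _ _ /all_in1 IH m n m0 n1 /= /all_in_cat[mG /all_in1[_ mB]] nD.
  by apply: (IH r) => //=; apply/all_in_cat; split=> //; apply/all_in1.
- move=> G D A B q1 /all_in2[p1 p2] /all_in2[IH1 IH2].
  apply/valid_succedent_last => // m m0 mG mD; split.
    by move/valid_succedent_last: (IH1 r); apply.
  by move/valid_succedent_last: (IH2 r); apply.
- move=> G D A B _ _ /all_in2[IHA IHB] m n m0 n1 /= /all_in_cat[mG /all_in1[_ mAB]] nD.
  have mn1 : narrow 1 (join m n) by narrow_sizes.
  suff H : prov (join m (join m n)) by weaken H.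
  apply: mAB => // m' m'0 ABm'.
  have H : prov (join (join m' m) n); last by weaken H.
  have mG' : all_in (fun A => sat r (join m' m) A) G by apply: all_sat_joinr.
  have m'm0 : narrow 0 (join m' m) by narrow_sizes.
  case: ABm' => [Am'|Bm']; [apply: (IHA r)|apply: (IHB r)] => //=;
  by apply/all_in_cat; split=> //; apply/all_in1; apply: sem_joinl.
- move=> G D A B q1 /all_in1 p1 /all_in1 IH.
  apply/valid_succedent_last => // m m0 mG mD; apply: closure_id => //; left.
  by move/valid_succedent_last: (IH r); apply.
- move=> G D A B q1 /all_in1 p1 /all_in1 IH.
  apply/valid_succedent_last => // m m0 mG mD; apply: closure_id => //; right.
  by move/valid_succedent_last: (IH r); apply.
- move=> G D G' D' A B _ _ /all_in2[IHA IHB] m n m0 n1 /=.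
  case/all_in_cat=> mG /all_in_cat[mG' /all_in1[_ mAB]] /all_in_cat[nD nD'].
  have mn1 : narrow 1 (join m n) by narrow_sizes.
  suff H : prov (join m (join m n)) by weaken H.
  apply: (IHA r) => //=; apply/all_in_cat; split; first exact: all_orth_join.
  apply/all_in1 => m' m'0 Am'.
  have H : prov (join (join m m') n); last by weaken H.
  apply: (IHB r) => //=; first by narrow_sizes.
  apply/all_in_cat; split; first exact: all_sat_joinl.
  by apply/all_in1; apply: mAB.
- move=> G D A B q1 /all_in1 p1 /all_in1 IH.
  apply/valid_succedent_last => // m m0 mG mD; split=> // m' m'0 Am'.
  move/valid_succedent_last: (IH r); apply=> //; first by narrow_sizes.
    apply/all_in_cat; split; first exact: all_sat_joinl.
    by apply/all_in1; apply: sem_joinr.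
  move=> C /mD mC m1 n m10 Cm1 n1.
  suff H : prov (join m (join m1 (join m' n))) by weaken H.
  by apply: mC => //; narrow_sizes.
- move=> G D A t _ _ /all_in1 IH m n m0 n1 /= /all_in_cat[mG /all_in1[_ mA]] nD.
  apply: (IH r) => //=; apply/all_in_cat; split=> //; apply/all_in1.
  by apply/sat_inst_body; apply: mA.
- move=> G D A v; rewrite has_cat negb_or => /andP[vG vD] vA q1 /all_in1 p1 /all_in1 IH.
  apply/valid_succedent_last => // m m0 mG mD; split=> // t.
  (* The premise is valid in all environments, so the eigenvariable may denote
     any t. *)
  pose r' w := if w == v then t else r w.
  have : sat r' m (inst_body A (FVar v)).
    move/valid_succedent_last: (IH r'); apply=> //.
      move=> F F_in.
      exact: (iffLR (sem_fresh r t BVar m (In_has vG F_in)) (mG F F_in)).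
    move=> F F_in m' n m'0 Fm'; apply: (mD F) => //=.
    exact: (iffRL (sem_fresh r t BVar m' (In_has vD F_in)) Fm').
  rewrite sat_inst_body /= /r' eqxx.
  exact: (iffRL (sem_fresh r t (scons t BVar) m vA)).
- move=> G D A v; rewrite has_cat negb_or => /andP[vG vD] vA _ _ /all_in1 IH.
  move=> m n m0 n1 /= /all_in_cat[mG /all_in1[_ mA]] nD.
  have mn1 : narrow 1 (join m n) by narrow_sizes.
  suff H : prov (join m (join m n)) by weaken H.
  apply: mA => // m' m'0 [t Am'].
  have H : prov (join (join m' m) n); last by weaken H.
  pose r' w := if w == v then t else r w.
  apply: (IH r') => //=; first by narrow_sizes.
    apply/all_in_cat; split.
      move=> F F_in; apply: (iffLR (sem_fresh r t BVar _ (In_has vG F_in))).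
      by apply: sem_joinr => //; apply: mG.
    apply/all_in1; apply: sem_joinl => //.
    rewrite sat_inst_body /= /r' eqxx.
    exact: (iffLR (sem_fresh r t (scons t BVar) m' vA) Am').
  move=> F F_in m1 m10 Fm1; apply: (nD F) => //=.
  exact: (iffRL (sem_fresh r t BVar m1 (In_has vD F_in)) Fm1).
- move=> G D A t q1 /all_in1 p1 /all_in1 IH.
  apply/valid_succedent_last => // m m0 mG mD; apply: closure_id => //.
  exists (tsubst r BVar t); apply/sat_inst_body.
  by move/valid_succedent_last: (IH r); apply.
Qed.

(** ** Completeness *)

Notation singleL A := ([:: A] ⇒ [::]).
Notation singleR A := ([::] ⇒ [:: A]).

(** The first part reflects the left rules of R and the second the right rules;
    negation and implication make each depend on the other. *)
Definition complete n (F : pformula L n) : Prop := forall r (s : 'I_n -> term L),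
  sem F r s (singleL (fsubst r s F)) /\
  forall m, sem F r s m -> prov (join m (singleR (fsubst r s F))).

Lemma narrow_singleL (A : formula L) : narrow 0 (singleL A).
Proof. by []. Qed.

Lemma prov_logical1 p q : logical_rule [:: p] q -> prov p -> narrow 1 q -> prov q.
Proof.
by move=> pq prov_p q1; apply: (prov_logical gentzen_R pq) => //; apply/all_in1.
Qed.

Lemma prov_logical2 p1 p2 q : logical_rule [:: p1; p2] q ->
  prov p1 -> prov p2 -> narrow 1 q -> prov q.
Proof.
by move=> pq p1P p2P q1; apply: (prov_logical gentzen_R pq) => //; apply/all_in2.
Qed.

Lemma sem_complete n (F : pformula L n) : complete F.
Proof.
elim: F => {n}.
- move=> n p a r s; split=> /= [|m [m0]].
    apply: closure_id => //; exists [ffun i => tsubst r s (a i)]; first by left.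
    by move=> i; rewrite ffunE; apply: eqv_refl.
  apply=> // m' m'0 [b b_in ab].
  have H : prov (antecedent m' ⇒ [:: Pred p [ffun i => tsubst r s (a i)]]).
    by apply: R_equational.2 b_in _ => i; rewrite ffunE.
  by weaken H.
- move=> n t u r s; split=> /= [|m [m0]].
    by apply: closure_id => //; apply: eqv_base; left.
  by apply=> // m' m'0 /R_equational.1 H; weaken H.
- move=> n A IH r s; have [Al Ar] := IH r s; split=> /= [|m [m0 mA]].
    split=> // m' n' m'0 /Ar Am' n'1.
    have H : prov (antecedent m' ++ [:: Neg (fsubst r s A)] ⇒ succedent m').
      apply: (prov_logical1 (NegL _ _ _)); last by narrow_sizes.
      by weaken Am'.
    by weaken H.
  have H := mA _ ([::] ⇒ [::]) (narrow_singleL _) Al (fun=> isT).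
  have {}H : prov (antecedent m ++ [:: fsubst r s A] ⇒ succedent m) by weaken H.
  have {}H := prov_logical1 (NegR _ _ _) H; conclude H.
- move=> n A IHA B IHB r s; have [Al Ar] := IHA r s; have [Bl Br] := IHB r s.
  split=> /= [|m [Am Bm]].
    split; apply: sem_closed; split=> // n' n'1 n'P.
      have H : prov (antecedent n' ++ [:: fsubst r s A] ⇒ succedent n').
        by have H := n'P _ (narrow_singleL _) Al; weaken H.
      by have {}H := prov_logical1 (AndL1 _ _ _ (fsubst r s B)) H; conclude H.
    have H : prov (antecedent n' ++ [:: fsubst r s B] ⇒ succedent n').
      by have H := n'P _ (narrow_singleL _) Bl; weaken H.
    by have {}H := prov_logical1 (AndL2 _ _ (fsubst r s A) _) H; conclude H.
  have m0 := sem_narrow Am.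
  have HA : prov (antecedent m ⇒ succedent m ++ [:: fsubst r s A]).
    by have H := Ar m Am; weaken H.
  have HB : prov (antecedent m ⇒ succedent m ++ [:: fsubst r s B]).
    by have H := Br m Bm; weaken H.
  by have H := prov_logical2 (AndR _ _ _ _) HA HB; conclude H.
- move=> n A IHA B IHB r s; have [Al Ar] := IHA r s; have [Bl Br] := IHB r s.
  split=> /= [|m [m0]].
    split=> // n' n'1 n'P.
    have HA : prov (antecedent n' ++ [:: fsubst r s A] ⇒ succedent n').
      by have H := n'P _ (narrow_singleL _) (or_introl Al); weaken H.
    have HB : prov (antecedent n' ++ [:: fsubst r s B] ⇒ succedent n').
      by have H := n'P _ (narrow_singleL _) (or_intror Bl); weaken H.
    by have H := prov_logical2 (OrL _ _ _ _) HA HB; conclude H.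
  apply=> // m' m'0 [/Ar Am'|/Br Bm'].
    have H : prov (antecedent m' ⇒ succedent m' ++ [:: fsubst r s A]) by weaken Am'.
    by have {}H := prov_logical1 (OrR1 _ _ _ (fsubst r s B)) H; conclude H.
  have H : prov (antecedent m' ⇒ succedent m' ++ [:: fsubst r s B]) by weaken Bm'.
  by have {}H := prov_logical1 (OrR2 _ _ (fsubst r s A) _) H; conclude H.
- move=> n A IHA B IHB r s; have [Al Ar] := IHA r s; have [Bl Br] := IHB r s.
  split=> /= [|m [m0 mAB]].
    split=> // m' m'0 /Ar Am'; apply: sem_closed.
    split=> [|n' n'1 Bn']; first by narrow_sizes.
    have HA : prov (antecedent m' ⇒ succedent m' ++ [:: fsubst r s A]) by weaken Am'.
    have HB : prov (antecedent n' ++ [:: fsubst r s B] ⇒ succedent n').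
      by have H := Bn' _ (narrow_singleL _) Bl; weaken H.
    by have H := prov_logical2 (ImpL _ _ _ _ _ _) HA HB; conclude H.
  have H : prov (antecedent m ++ [:: fsubst r s A]
                 ⇒ succedent m ++ [:: fsubst r s B]).
    by have H := Br _ (mAB _ (narrow_singleL _) Al); weaken H.
  by have {}H := prov_logical1 (ImpR _ _ _ _) H; conclude H.
- move=> n A IH r s /=; set A' := fsubst _ _ A.
  have A'E t : inst_body A' t = fsubst r (scons t s) A by apply: inst_body_fsubst.
  split=> [|m [m0 mA]].
    split=> // t; apply: sem_closed; split=> // n' n'1 n'P.
    have H : prov (antecedent n' ++ [:: inst_body A' t] ⇒ succedent n').
      rewrite A'E; have [Al _] := IH r (scons t s).
      by have H := n'P _ (narrow_singleL _) Al; weaken H.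
    by have {}H := prov_logical1 (AllL _ _ _ _) H; conclude H.
  have [v] := fresh_fvar fvar_infinite (All A' :: antecedent m ++ succedent m).
  rewrite /= negb_or => /andP[v_A' v_m].
  have H : prov (antecedent m ⇒ succedent m ++ [:: inst_body A' (FVar v)]).
    rewrite A'E; have [_ Ar] := IH r (scons (FVar v) s).
    by have H := Ar m (mA _); weaken H.
  by have {}H := prov_logical1 (AllR v_m v_A') H; conclude H.
- move=> n A IH r s /=; set A' := fsubst _ _ A.
  have A'E t : inst_body A' t = fsubst r (scons t s) A by apply: inst_body_fsubst.
  split=> [|m [m0]].
    split=> // n' n'1 n'P.
    have [v] := fresh_fvar fvar_infinite (Ex A' :: antecedent n' ++ succedent n').
    rewrite /= negb_or => /andP[v_A' v_n'].
    have H : prov (antecedent n' ++ [:: inst_body A' (FVar v)] ⇒ succedent n').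
      rewrite A'E; have [Al _] := IH r (scons (FVar v) s).
      by have H := n'P _ (narrow_singleL _) (ex_intro _ (FVar v) Al); weaken H.
    by have {}H := prov_logical1 (ExL v_n' v_A') H; conclude H.
  apply=> // m' m'0 [t Am'].
  have H : prov (antecedent m' ⇒ succedent m' ++ [:: inst_body A' t]).
    rewrite A'E; have [_ Ar] := IH r (scons t s).
    by have H := Ar m' Am'; weaken H.
  by have {}H := prov_logical1 (ExR _ _ _ _) H; conclude H.
Qed.

Lemma prov_valid q : narrow 1 q -> (forall r, valid r q) -> prov q.
Proof.
move=> q1 q_valid.
suff H : prov (join (antecedent q ⇒ [::]) ([::] ⇒ succedent q)) by weaken H.
apply: (q_valid FVar) => //= [A A_in|B B_in m m0 Bm].
  have [Al _] := sem_complete A FVar BVar; rewrite fsubst_id in Al.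
  apply: sem_sub Al _ _ => //; split=> // x /= [<-|//].
  exact: A_in.
have [_ Br] := sem_complete B FVar BVar; have H := Br m Bm.
rewrite fsubst_id in H; apply: (prov_sub gentzen_R H); last by narrow_sizes.
split=> x; rewrite /= ?cats0 // !In_cat /=; case=> [|[<-|//]]; tauto.
Qed.

(** With cut in R' but not in R this is cut elimination. *)
Theorem prov_of_sound (R' : rule L) q :
  sound R' -> derivable (restrict c R') q -> prov q.
Proof.
move=> R'_sound q_der; apply: prov_valid.
  by case: q_der => ps p /restrictP[_ nar] _; apply: nar; left.
elim: q_der => {}ps {}q /restrictP[R'q nar] _ IH.
exact: (R'_sound ps).
Qed.

Lemma sound_or (R1 R2 : rule L) : sound R1 -> sound R2 -> sound (R1 ⊎ R2).
Proof. by move=> s1 s2 ps q [/s1|/s2]; apply. Qed.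

Lemma prov_of_ext S q : derivable (ext c S) q -> prov q.
Proof.
apply: prov_of_sound; apply: sound_or sound_cut.
apply: sound_or (@sound_eq_rules S); apply: sound_or sound_refl.
exact: sound_or (sound_or sound_axiom sound_structural) sound_logical.
Qed.

Lemma prov_of_reference (q : sequent L) : derivable (reference c) q -> prov q.
Proof.
apply: prov_of_sound; apply: sound_or sound_cut.
apply: sound_or sound_congruence; apply: sound_or sound_refl.
exact: sound_or (sound_or sound_axiom sound_structural) sound_logical.
Qed.

End Model.

(** * Deriving equational consequences *)

(** The orientation o = true stands for the rules =_1 and =_1^l, and o = false
    for =_2 and =_2^l.  In either case the term u of the conclusion comes from
    the term t of the premise. *)
Definition oriented (L : language) (o : bool) (t u : term L) : formula L :=
  if o then Equ t u else Equ u t.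

Definition right_name o := if o then Eq1 else Eq2.
Definition left_name o := if o then Eq1l else Eq2l.

Lemma eq_rule_right (L : language) o G D (F : formula L) v t u :
  ~~ tocc v t -> ~~ tocc v u ->
  eq_rule (right_name o) [:: G ⇒ D ++ [:: repl F v t]]
    (G ++ [:: oriented o t u] ⇒ D ++ [:: repl F v u]).
Proof. by case: o; constructor. Qed.

Lemma eq_rule_left (L : language) o G D (F : formula L) v t u :
  ~~ tocc v t -> ~~ tocc v u ->
  eq_rule (left_name o) [:: G ++ [:: repl F v t] ⇒ D]
    (G ++ [:: repl F v u; oriented o t u] ⇒ D).
Proof. by case: o; constructor. Qed.

Section Replacement.
Variables (L : language) (c : logic) (R : rule L).
Hypothesis fvar_infinite : forall vs : seq (fvar L), exists v, v \notin vs.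
Hypothesis gentzen_R : forall ps q, gentzen_cut_free ps q -> R ps q.
Hypothesis refl_R : forall ps q, reflexivity_axiom ps q -> R ps q.
Notation prov := (derivable (restrict c R)).

Lemma prov_refl G t : prov (G ⇒ [:: Equ t t]).
Proof.
apply: (@prov_inclL _ _ _ gentzen_R [::]) => //.
by apply: (@prov_rule _ _ _ [::]) => //; apply: refl_R.
Qed.

(** Replacement in both directions in the succedent follows [eqv] step by
    step. *)
Lemma equational_of_replacement :
  (forall G (F : formula L) v t u, ~~ tocc v t -> ~~ tocc v u ->
     List.In (Equ t u) G \/ List.In (Equ u t) G ->
     prov (G ⇒ [:: repl F v t]) -> prov (G ⇒ [:: repl F v u])) ->
  equational c R.
Proof.
move=> replace.
have replaceK G t u : eqv G t u -> forall K, template K ->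
    prov (G ⇒ [:: K t]) <-> prov (G ⇒ [:: K u]).
  elim=> {t u}.
  - move=> t u tu K /(template_fresh fvar_infinite t u)[F [v [vt vu KE]]].
    by rewrite !KE; split; apply: replace => //; [left|right].
  - by [].
  - by move=> t u _ IH K /IH[].
  - by move=> t u x _ IHtu _ IHux K KP; apply: iff_trans (IHtu K KP) (IHux K KP).
  - move=> f a b _ IH K KP.
    pose J x y := forall K, template K ->
      prov (G ⇒ [:: K x]) <-> prov (G ⇒ [:: K y]).
    suff gen (a' b' : {ffun 'I_(fun_arity f) -> term L}) :
        (forall i, J (a' i) (b' i)) ->
        prov (G ⇒ [:: K (App f a')]) -> prov (G ⇒ [:: K (App f b')]).
      by split; apply: gen => i K' K'P; [|apply: iff_sym]; apply: IH.
    apply: (ffun_stepwise (Q := fun a => prov (G ⇒ [:: K (App f a)]))) => a1 i x y xy.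
    exact: (iffLR (xy _ (template_App fvar_infinite a1 i KP))).
split=> [G t u tu | G p a b b_in ab].
  by apply/(replaceK _ _ _ tu _ (template_Equ_r fvar_infinite t)); apply: prov_refl.
pose J x y := eqv G y x.
apply: (ffun_stepwise (J := J) (Q := fun a => prov (G ⇒ [:: Pred p a])) _ ab).
  move=> a1 i x y yx.
  exact: (iffRL (replaceK _ _ _ yx _ (template_Pred fvar_infinite a1 i))).
apply: prov_inclL (prov_axiom c gentzen_R (Pred p b)) => //.
by move=> F [<-|[]].
Qed.

(** With cut one orientation suffices: replacing the first side of t = t gives
    the symmetry of equality, and cutting against it gives the other
    orientation. *)
Lemma equational_of_cut o :
  (forall ps q, cut_rule ps q -> R ps q) ->
  (forall (F : formula L) v t u, ~~ tocc v t -> ~~ tocc v u ->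
     prov ([:: repl F v t; oriented o t u] ⇒ [:: repl F v u])) ->
  equational c R.
Proof.
move=> cut_R half.
have cut G A B : prov (G ⇒ [:: A]) -> prov (A :: G ⇒ [:: B]) -> prov (G ⇒ [:: B]).
  move=> GA AGB.
  apply: (@prov_inclL _ _ _ gentzen_R (G ++ G)); first by in_lists.
  apply: (@prov_rule _ _ _ [:: G ⇒ [::] ++ [:: A]; G ++ [:: A] ⇒ [:: B]]) => //.
    by apply: cut_R; apply: (Cut G [::] G [:: B] A).
  by apply/all_in2; split=> //; apply: prov_inclL AGB => //; in_lists.
have halfK K t u : template K -> prov ([:: K t; oriented o t u] ⇒ [:: K u]).
  move=> /(template_fresh fvar_infinite t u)[F [v [vt vu KE]]].
  by rewrite !KE; apply: half.
have sym t u : prov ([:: oriented o t u] ⇒ [:: oriented o u t]).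
  apply: (cut _ (oriented o t t)).
    by case: (o); apply: prov_refl.
  apply: (halfK (fun x => oriented o x t)).
  by case: (o); [apply: template_Equ_l|apply: template_Equ_r].
apply: equational_of_replacement => G F v t u _ _ tu Ft.
apply: (cut _ _ _ Ft).
have [tu_in|ut_in] : List.In (oriented o t u) G \/ List.In (oriented o u t) G.
- by case: (o) tu => [[]|[]]; tauto.
- apply: prov_inclL (halfK _ t u (template_repl F v)) => //.
  by move=> x [<-|[<-|[]]]; [left|right].
apply: (cut _ (oriented o t u)).
  by apply: prov_inclL (sym u t) => // x [<-|[]]; right.
apply: prov_inclL (halfK _ t u (template_repl F v)) => //.
by move=> x [<-|[<-|[]]]; [right; left|left].
Qed.

End Replacement.

(** * Oriented equations and confluence *)

Section Completion.
Variables (L : language) (o : bool) (G : seq (formula L)).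

(** The equations of G are read as rewriting rules u → t in the only sense that
    the rules of orientation o allow.  The equations themselves are then
    rewritten on the side u, and become new rules; this is a completion
    procedure for the equations G. *)
Inductive completed : term L -> term L -> Prop :=
| completed_base t u : List.In (oriented o t u) G -> completed t u
| completed_rewrite t u u' : completed t u -> rewrites u u' -> completed t u'
with rewrites : term L -> term L -> Prop :=
| rewrites_root t u : completed t u -> rewrites u t
| rewrites_arg f (a : {ffun 'I_(fun_arity f) -> term L}) i x :
    rewrites (a i) x -> rewrites (App f a) (App f (upd a i x)).

Scheme completed_mind := Minimality for completed Sort Prop
  with rewrites_mind := Minimality for rewrites Sort Prop.
Combined Scheme completed_rewrites_ind from completed_mind, rewrites_mind.

Definition reduces : term L -> term L -> Prop :=
  clos_refl_trans_1n (term L) rewrites.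

Definition joinable t u : Prop := exists2 x, reduces t x & reduces u x.

Lemma reduces_refl t : reduces t t.
Proof. exact: rt1n_refl. Qed.

Lemma reduces_step t u x : rewrites t u -> reduces u x -> reduces t x.
Proof. exact: rt1n_trans. Qed.

Lemma rewritesP t x : rewrites t x ->
  completed x t \/
  if t is App f a then exists i y, rewrites (a i) y /\ x = App f (upd a i y)
  else False.
Proof. by case=> [u y ?|f a i y ?]; [left | right; exists i, y]. Qed.

(** If t is rewritten to x at its root and to y in any other way, then rewriting
    the equation x = t itself turns it into x = y, and so y rewrites to x in
    one step.  Two steps inside t that are not nested commute. *)
Lemma rewrites_diamond t x y : rewrites t x -> rewrites t y ->
  exists z, (x = z \/ rewrites x z) /\ (y = z \/ rewrites y z).
Proof.
move=> tx; elim: tx y => {t x} [x t xt|f a i x ax IH] y.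
  move=> ty; exists x; split; first by left.
  by right; apply: rewrites_root; apply: completed_rewrite ty.
move=> ty; case/rewritesP: (ty) => [yt|[j [x' [ax' y_eq]]]].
  exists y; split; last by left.
  right; apply: rewrites_root; apply: completed_rewrite yt _.
  exact: rewrites_arg.
subst y; case: (eqVneq i j) => [eq_ij|ne_ij]; last first.
  exists (App f (upd (upd a i x) j x')); split; right.
    by apply: rewrites_arg; rewrite ffunE eq_sym (negPf ne_ij).
  by rewrite upd_comm //; apply: rewrites_arg; rewrite ffunE (negPf ne_ij).
subst j; have [z [xz x'z]] := IH x' ax'.
have arg x1 : x1 = z \/ rewrites x1 z ->
    App f (upd a i x1) = App f (upd a i z) \/
    rewrites (App f (upd a i x1)) (App f (upd a i z)).
  case=> [->|x1z]; [by left | right].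
  by rewrite -(upd_upd a i x1 z); apply: rewrites_arg; rewrite updE.
by exists (App f (upd a i z)); split; apply: arg.
Qed.

Lemma reduces_trans t u x : reduces t u -> reduces u x -> reduces t x.
Proof. by elim=> // t' u' x' tu _ IH /IH; apply: reduces_step. Qed.

Lemma rewrites_strip t x y : rewrites t x -> reduces t y ->
  exists2 z, reduces x z & y = z \/ rewrites y z.
Proof.
move=> tx ty; elim: ty x tx => {t y} [t|t u y tu uy IH] x tx.
  by exists x; [apply: reduces_refl | right].
have [z [[<-|xz] [uz|uz]]] := rewrites_diamond tx tu.
- by exists y; [rewrite -uz | left].
- by have [z' zz' yz'] := IH _ uz; exists z'.
- by exists y; [rewrite uz in uy; apply: reduces_step uy | left].
- have [z' zz' yz'] := IH _ uz; exists z' => //.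
  exact: reduces_step zz'.
Qed.

Lemma reduces_confluent t x y : reduces t x -> reduces t y -> joinable x y.
Proof.
move=> tx; elim: tx y => {t x} [t|t u x tu _ IH] y ty.
  by exists y; last apply: reduces_refl.
have [z uz yz] := rewrites_strip tu ty; have [w xw zw] := IH _ uz.
exists w => //; case: yz => [->//|yz]; exact: reduces_step zw.
Qed.

Lemma joinable_trans t u x : joinable t u -> joinable u x -> joinable t x.
Proof.
move=> [y ty uy] [z uz xz]; have [w yw zw] := reduces_confluent uy uz.
by exists w; [apply: reduces_trans yw | apply: reduces_trans zw].
Qed.

Lemma reduces_App f (a b : {ffun 'I_(fun_arity f) -> term L}) :
  (forall i, reduces (a i) (b i)) -> reduces (App f a) (App f b).
Proof.
move=> ab; apply: (ffun_stepwise (Q := fun b => reduces (App f a) (App f b))) ab _;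
  last exact: reduces_refl.
move=> a' i x y xy H; apply: reduces_trans H _.
elim: xy => [t|t u z tu _ IH]; first exact: reduces_refl.
apply: reduces_step IH; rewrite -(upd_upd a' i t u).
by apply: rewrites_arg; rewrite updE.
Qed.

Lemma joinable_eqv t u : eqv G t u -> joinable t u.
Proof.
elim=> {t u}.
- move=> t u tu; have [tu'|ut'] : completed t u \/ completed u t.
    by case oE: o; [left|right]; apply: completed_base; rewrite oE.
  + exists t; [exact: reduces_refl | apply: reduces_step (reduces_refl _)].
    exact: rewrites_root.
  + exists u; [apply: reduces_step (reduces_refl _) | exact: reduces_refl].
    exact: rewrites_root.
- by move=> t; exists t; apply: reduces_refl.
- by move=> t u _ [x tx ux]; exists x.
- by move=> t u x _ tu _; apply: joinable_trans.
- move=> f a b _ IH.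
  have {}IH i : exists x, reduces (a i) x /\ reduces (b i) x.
    by have [x] := IH i; exists x.
  have [x xP] := fin_all_exists IH.
  by exists (App f [ffun i => x i]); apply: reduces_App => i;
     rewrite ffunE; case: (xP i).
Qed.

End Completion.

Section OrientedReplacement.
Variables (L : language) (c : logic) (R : rule L) (o : bool).
Hypothesis fvar_infinite : forall vs : seq (fvar L), exists v, v \notin vs.
Hypothesis gentzen_R : forall ps q, gentzen_cut_free ps q -> R ps q.
Hypothesis refl_R : forall ps q, reflexivity_axiom ps q -> R ps q.
Notation prov := (derivable (restrict c R)).
Hypothesis right_R : forall ps q, eq_rule (right_name o) ps q -> R ps q.
Hypothesis left_R : forall ps q, eq_rule (left_name o) ps q -> R ps q.

Lemma prov_right G K t u : template K -> List.In (oriented o t u) G ->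
  prov (G ⇒ [:: K t]) -> prov (G ⇒ [:: K u]).
Proof.
move=> /(template_fresh fvar_infinite t u)[F [v [vt vu KE]]] tu.
rewrite !KE => H.
apply: (@prov_inclL _ _ _ gentzen_R (G ++ [:: oriented o t u])).
  by move=> x /In_cat[//|[<-|[]]].
apply: (prov_rule (ps := [:: G ⇒ [:: repl F v t]])) => //.
  by apply: right_R; apply: (eq_rule_right o G [::] F vt vu).
by apply/all_in1.
Qed.

Lemma prov_left G D K t u : template K -> List.In (oriented o t u) G ->
  prov (G ++ [:: K t] ⇒ D) -> prov (G ++ [:: K u] ⇒ D).
Proof.
move=> /(template_fresh fvar_infinite t u)[F [v [vt vu KE]]] tu.
rewrite !KE => H.
apply: (@prov_inclL _ _ _ gentzen_R (G ++ [:: repl F v u; oriented o t u])).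
  move=> x /In_cat[x_G|[<-|[<-|[]]]]; apply/In_cat; [by left|by right; left|by left].
apply: (prov_rule (ps := [:: G ++ [:: repl F v t] ⇒ D])).
- by apply: left_R; apply: eq_rule_left.
- by have := prov_narrow H.
- by apply/all_in1.
Qed.

(** Rewriting can be undone on either side of a sequent, and completed equations
    may be dropped from the antecedent.  The two statements need each other: a
    rewriting step uses a completed equation as a premise, and a completed
    equation is produced by rewriting an equation in the antecedent with the
    left rule. *)
Lemma prov_completed_rewrites G :
  (forall t u, completed o G t u -> forall G' D, List.incl G G' ->
     prov (G' ++ [:: oriented o t u] ⇒ D) -> prov (G' ⇒ D)) /\
  (forall u t, rewrites o G u t -> forall G' K, List.incl G G' -> template K ->
     (prov (G' ⇒ [:: K t]) -> prov (G' ⇒ [:: K u])) /\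
     forall D, prov (G' ++ [:: K t] ⇒ D) -> prov (G' ++ [:: K u] ⇒ D)).
Proof.
apply: completed_rewrites_ind.
- move=> t u tu G' D GG'; apply: prov_inclL => // x.
  by move=> /In_cat[//|[<-|[]]]; apply: GG'.
- move=> t u u' _ IHt _ IHu G' D GG' H; apply: IHt => //.
  have tmp : template (oriented o t).
    by case: (o); [apply: template_Equ_r|apply: template_Equ_l].
  by apply: (IHu _ _ GG' tmp).2.
- move=> t u _ IH G' K GG' KP; split=> [H|D H]; apply: IH.
  + exact: GG'.
  + apply: prov_right KP _ _; first by apply/In_cat; right; left.
    by apply: prov_inclL H => //; in_lists.
  + by move=> x /GG' x_G'; apply/In_cat; left.
  + have {}H : prov ((G' ++ [:: oriented o t u]) ++ [:: K t] ⇒ D).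
      by apply: prov_inclL H => //; in_lists.
    have {}H : prov ((G' ++ [:: oriented o t u]) ++ [:: K u] ⇒ D).
      by apply: prov_left KP _ H; apply/In_cat; right; left.
    by apply: prov_inclL H => //; in_lists.
- move=> f a i x _ IH G' K GG' KP.
  have [IHr IHl] := IH _ _ GG' (template_App fvar_infinite a i KP).
  by rewrite upd_id in IHr IHl.
Qed.

Lemma prov_reduces_right G G' K t u : reduces o G u t -> List.incl G G' ->
  template K -> prov (G' ⇒ [:: K t]) -> prov (G' ⇒ [:: K u]).
Proof.
have [_ step] := prov_completed_rewrites G.
move=> ut GG' KP; elim: ut => // {}u {}t x ut _ IH /IH.
exact: (step _ _ ut _ _ GG' KP).1.
Qed.

Lemma prov_reduces_left G G' D K t u : reduces o G u t -> List.incl G G' ->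
  template K -> prov (G' ++ [:: K t] ⇒ D) -> prov (G' ++ [:: K u] ⇒ D).
Proof.
have [_ step] := prov_completed_rewrites G.
move=> ut GG' KP; elim: ut => // {}u {}t x ut _ IH /IH.
exact: (step _ _ ut _ _ GG' KP).2.
Qed.

(** From the common reduct x the right rule reaches both sides of t = u.  For
    P(b) ⇒ P(a) the right rule leads from the common reduct to a and the left
    rule from the common reduct to b. *)
Lemma equational_of_oriented : equational c R.
Proof.
split=> [G t u /(joinable_eqv o)[x tx ux] | G p a b b_in ab].
  apply: (prov_reduces_right ux _ (template_Equ_r fvar_infinite t)) => //.
  apply: (prov_reduces_right tx _ (template_Equ_l fvar_infinite x)) => //.
  exact: prov_refl.
have {}ab i : exists x, reduces o G (a i) x /\ reduces o G (b i) x.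
  by have [x] := joinable_eqv o (ab i); exists x.
have [x xP] := fin_all_exists ab.
pose J u t := reduces o G t u; pose d := [ffun i => x i].
have H : prov (G ++ [:: Pred p d] ⇒ [:: Pred p a]).
  pose Q a := prov (G ++ [:: Pred p d] ⇒ [:: Pred p a]).
  apply: (ffun_stepwise (J := J) (Q := Q) (a := d)).
  - move=> a' i u t ut.
    by apply: (prov_reduces_right ut _ (template_Pred fvar_infinite a' i)); in_lists.
  - by move=> i; rewrite ffunE; case: (xP i).
  - apply: prov_inclL (prov_axiom c gentzen_R (Pred p d)) => //; in_lists.
apply: (@prov_inclL _ _ _ gentzen_R (G ++ [:: Pred p b])).
  by move=> F /In_cat[//|[<-|[]]].
pose Q b := prov (G ++ [:: Pred p b] ⇒ [:: Pred p a]).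
apply: (ffun_stepwise (J := J) (Q := Q) (a := d)) => //.
- move=> a' i u t ut.
  exact: (prov_reduces_left ut _ (template_Pred fvar_infinite a' i)).
- by move=> i; rewrite ffunE; case: (xP i).
Qed.

End OrientedReplacement.

(** * Underivable sequents of equations *)

Definition equation (L : language) n (F : pformula L n) :
    option (pterm L n * pterm L n) :=
  match F with Equ _ t u => Some (t, u) | _ => None end.

Definition equation_in (L : language) (P : term L -> term L -> Prop)
    (F : formula L) : Prop :=
  if equation F is Some (t, u) then P t u else False.

Definition trepl (L : language) v (t u : term L) : term L :=
  tsubst (fun w => if w == v then t else FVar w) BVar u.

Lemma equation_repl (L : language) (F : formula L) v t :
  equation (repl F v t)
  = if equation F is Some (x, y) then Some (trepl v t x, trepl v t y) else None.
Proof.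
suff gen m n (A : pformula L m) (r : fvar L -> pterm L n) s :
    equation (fsubst r s A)
    = if equation A is Some (x, y) then Some (tsubst r s x, tsubst r s y) else None.
  exact: gen.
by case: A s.
Qed.

Lemma trepl_FVar (L : language) v w (t u : term L) :
  trepl v t u = FVar w -> u = FVar v /\ t = FVar w \/ u = FVar w /\ w != v.
Proof.
rewrite /trepl; case: u => [z|[]//|//] /=.
by case: (eqVneq z v) => [->|ne_zv] => [->|[<-]]; [left | right].
Qed.

(** If the antecedents are equations in P and the succedents are equations in Q,
    and the equality rules read upwards preserve this, then no cut-free
    derivation exists: logical rules have no equation as principal formula, and
    the axioms are excluded. *)

Section Invariant.
Variables (L : language) (S : pred eq_name) (P Q : term L -> term L -> Prop).
Hypothesis PQ : forall t u, P t u -> ~ Q t u.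
Hypothesis Q_irrefl : forall t, ~ Q t t.
Hypothesis Q_right : forall o v t u x y, S (right_name o) ->
  equation_in P (oriented o t u) ->
  Q (trepl v u x) (trepl v u y) -> Q (trepl v t x) (trepl v t y).
Hypothesis P_left : forall o v t u x y, S (left_name o) ->
  equation_in P (oriented o t u) ->
  P (trepl v u x) (trepl v u y) -> P (trepl v t x) (trepl v t y).

Lemma equation_in_repl (P' : term L -> term L -> Prop) (F : formula L) v t u :
  (forall x y, P' (trepl v u x) (trepl v u y) -> P' (trepl v t x) (trepl v t y)) ->
  equation_in P' (repl F v u) -> equation_in P' (repl F v t).
Proof. by move=> P't; rewrite /equation_in !equation_repl; case: equation => [[]|]. Qed.

Lemma underivable_equations c q : derivable (ext_cut_free c S) q ->
  all_in (equation_in P) (antecedent q) -> all_in (equation_in Q) (succedent q) ->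
  False.
Proof.
elim=> {q} ps q /restrictP[rul _] _ IH Pq Qq.
have {}IH p : List.In p ps -> all_in (equation_in P) (antecedent p) ->
    all_in (equation_in Q) (succedent p) -> False by apply: IH.
case: rul IH Pq Qq => [[[[|]|]|]|[e e_S]].
- case=> F _ /all_in1 PF /all_in1; move: PF; rewrite /equation_in.
  by case: equation => // - [t u]; apply: PQ.
- by case=> [G D F|G D F|G G' D A B|G D D' A B|G D F|G D F] IH /= PG QD;
     apply: (IH _ (or_introl erefl)) => F' F'_in; (apply: PG || apply: QD);
     move: F'_in; rewrite /= ?In_cat /=; tauto.
- case=> /= *;
  by [match goal with
      | H : all_in _ (_ ++ [:: _]) |- _ => by case/all_in_cat: H => _ /all_in1
      | H : all_in _ (_ ++ _ ++ [:: _]) |- _ =>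
          by case/all_in_cat: H => _ /all_in_cat[_ /all_in1]
      end].
- by case=> t _ _ /all_in1; apply: Q_irrefl.
- have right o G D F v t u : S (right_name o) ->
      (all_in (equation_in P) G ->
       all_in (equation_in Q) (D ++ [:: repl F v t]) -> False) ->
      all_in (equation_in P) (G ++ [:: oriented o t u]) ->
      all_in (equation_in Q) (D ++ [:: repl F v u]) -> False.
    move=> oS IH /all_in_cat[PG /all_in1 Ptu] /all_in_cat[QD /all_in1 QF].
    apply: IH => //; apply/all_in_cat; split=> //; apply/all_in1.
    by apply: equation_in_repl QF => x y; apply: Q_right oS Ptu.
  have left o G D F v t u : S (left_name o) ->
      (all_in (equation_in P) (G ++ [:: repl F v t]) ->
       all_in (equation_in Q) D -> False) ->
      all_in (equation_in P) (G ++ [:: repl F v u; oriented o t u]) ->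
      all_in (equation_in Q) D -> False.
    move=> oS IH /all_in_cat[PG /all_in2[PF Ptu]] QD.
    apply: IH => //; apply/all_in_cat; split=> //; apply/all_in1.
    by apply: equation_in_repl PF => x y; apply: P_left oS Ptu.
  move=> rul; case: rul e_S => {e} G D F v t u _ _ e_S IH;
  have {}IH := IH _ (or_introl erefl).
  + exact: (right true).
  + exact: (right false).
  + exact: (left true).
  + exact: (left false).
Qed.

End Invariant.

Section Counterexamples.
Variables (L : language) (c : logic) (S : pred eq_name).

(** Without right rules the succedent does not change, and left rules turn
    equations between the variables a and b into such equations only. *)
Lemma congruence_underivable (f : fun_symb L) (a b : fvar L) :
  0 < fun_arity f -> a != b -> ~ S Eq1 -> ~ S Eq2 ->
  ~ derivable (ext_cut_free c S)
      ([:: Equ (FVar a) (FVar b)]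
       ⇒ [:: Equ (App f [ffun=> FVar a]) (App f [ffun=> FVar b])]).
Proof.
move=> f_pos ne_ab nS1 nS2 der.
pose ab (t : term L) := t = FVar a \/ t = FVar b.
pose P t u := ab t /\ ab u.
pose Q (t u : term L) := t = App f [ffun=> FVar a] /\ u = App f [ffun=> FVar b].
apply: (underivable_equations (P := P) (Q := Q) _ _ _ _ der).
- by move=> t u [[->|->] _] [].
- move=> t [t_a t_b]; have : tocc a t.
    by rewrite t_a; apply/existsP; exists (Ordinal f_pos); rewrite ffunE /= eqxx.
  by rewrite t_b => /existsP[i]; rewrite ffunE /= (negPf ne_ab).
- by case.
- have ab_repl v t u x : ab t -> ab (trepl v u x) -> ab (trepl v t x).
    by move=> abt; case=> /trepl_FVar[[-> _]|[-> ne]]; rewrite /trepl /= ?eqxx //;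
       rewrite (negPf ne); [left|right].
  move=> o v t u x y _ tu [abx aby].
  have abt : ab t by case: (o) tu => [[]|[]].
  by split; [apply: ab_repl abx | apply: ab_repl aby].
- by apply/all_in1; split; [left|right].
- by apply/all_in1; split.
Qed.

(** Here the left rule replaces x and y by z and the right rule replaces z by
    x or y, when read upwards; so z never enters the succedent and the only
    new antecedent is z = z. *)
Lemma common_side_underivable o (x y z : fvar L) : x != y -> x != z -> y != z ->
  ~ S (right_name (~~ o)) -> ~ S (left_name o) ->
  ~ derivable (ext_cut_free c S)
      ([:: oriented o (FVar x) (FVar z); oriented o (FVar y) (FVar z)]
       ⇒ [:: Equ (FVar x) (FVar y)]).
Proof.
move=> ne_xy ne_xz ne_yz nSr nSl der.
pose xyz (t : term L) := [\/ t = FVar x, t = FVar y | t = FVar z].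
pose P0 (t u : term L) := xyz t /\ u = FVar z.
pose P t u := if o then P0 t u else P0 u t.
pose Q (t u : term L) := t = FVar x /\ u = FVar y.
have FVar_inj (v w : fvar L) : v != w -> FVar (n := 0) v <> FVar w.
  by move=> /eqP ne_vw [].
have P_oriented o' t u : equation_in P (oriented o' t u) ->
    if o' == o then P0 t u else P0 u t.
  by rewrite /P; case: o'; case: (o).
apply: (underivable_equations (P := P) (Q := Q) _ _ _ _ der).
- move=> t u Ptu [t_x u_y]; move: Ptu; rewrite /P /P0 t_x u_y.
  by case: (o) => -[_]; apply: FVar_inj.
- by move=> t [->]; apply: FVar_inj.
- move=> o' v t u x' y' oS /P_oriented.
  have -> : o' = o by case: (o') (o) oS nSr => [] [].
  rewrite eqxx => -[_ ->] [x'x y'y].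
  have fix_repl w w' : w != z -> trepl v (FVar z) w' = FVar w -> trepl v t w' = FVar w.
    move=> ne_wz /trepl_FVar[[_ []]|[-> ne_wv]].
      by move/eqP: ne_wz => ne_wz /esym.
    by rewrite /trepl /= (negPf ne_wv).
  by split; apply: fix_repl.
- move=> o' v t u x' y' oS /P_oriented.
  have ne_o : o' <> o by move=> eq_o; rewrite eq_o in oS.
  rewrite (introF eqP ne_o) => -[xyz_u ->].
  have xyz_repl w : xyz (trepl v u w) -> xyz (trepl v (FVar z) w).
    by case=> /trepl_FVar[[-> _]|[-> ne]]; rewrite /trepl /= ?eqxx ?(negPf ne);
       [constructor 3|constructor 1|constructor 3
       |constructor 2|constructor 3|constructor 3].
  have z_repl w : trepl v u w = FVar z -> trepl v (FVar z) w = FVar z.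
    by case/trepl_FVar=> [[-> _]|[-> ne]]; rewrite /trepl /= ?eqxx ?(negPf ne).
  by rewrite /P; case: (o) => -[? ?]; split; do ?[exact: xyz_repl|exact: z_repl].
- apply/all_in2; rewrite /P; case: (o); split; split=> //;
  by [constructor 1|constructor 2].
- by apply/all_in1; split.
Qed.

End Counterexamples.

Section Main.
Variables (L : language) (c : logic) (S : pred eq_name).
Hypothesis fvar_infinite : forall vs : seq (fvar L), exists v, v \notin vs.

Lemma gentzen_ext_cut_free ps (q : sequent L) : gentzen_cut_free ps q ->
  (@gentzen_cut_free L ⊎ @reflexivity_axiom L ⊎ eq_rules S) ps q.
Proof. by left; left. Qed.

Lemma equational_cut_free :
  (S Eq1 /\ S Eq2) \/ (S Eq1 /\ S Eq1l) \/ (S Eq2 /\ S Eq2l) ->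
  equational c (@gentzen_cut_free L ⊎ @reflexivity_axiom L ⊎ eq_rules S).
Proof.
have gentzen := gentzen_ext_cut_free.
have refl ps q : reflexivity_axiom ps q ->
    (@gentzen_cut_free L ⊎ @reflexivity_axiom L ⊎ eq_rules S) ps q by left; right.
have eqs e ps q : S e -> eq_rule e ps q ->
    (@gentzen_cut_free L ⊎ @reflexivity_axiom L ⊎ eq_rules S) ps q.
  by right; exists e.
case=> [[S1 S2]|[[S1 S1l]|[S2 S2l]]].
- apply: equational_of_replacement => // G F v t u vt vu tu H.
  suff [o [So tuo]] : exists o, S (right_name o) /\ List.In (oriented o t u) G.
    apply: (@prov_inclL _ _ _ gentzen (G ++ [:: oriented o t u])).
      by move=> x /In_cat[//|[<-|[]]].
    apply: (prov_rule (ps := [:: G ⇒ [:: repl F v t]])) => //.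
      by apply: eqs So _; apply: (eq_rule_right o G [::] F vt vu).
    by apply/all_in1.
  by case: tu => tu; [exists true|exists false].
- by apply: (@equational_of_oriented _ _ _ true) => // ps q; apply: eqs.
- by apply: (@equational_of_oriented _ _ _ false) => // ps q; apply: eqs.
Qed.

Lemma equational_ext : (exists e, S e) ->
  equational c (@gentzen_cut_free L ⊎ @reflexivity_axiom L ⊎ eq_rules S
                ⊎ @cut_rule L).
Proof.
set R := _ ⊎ _; move=> [e Se].
have gentzen ps q : gentzen_cut_free ps q -> R ps q by left; left; left.
have refl ps q : reflexivity_axiom ps q -> R ps q by left; left; right.
have cut ps q : cut_rule ps q -> R ps q by right.
have ax F : derivable (restrict c R) ([:: F] ⇒ [:: F]) by apply: prov_axiom.
have half_right o : S (right_name o) -> equational c R.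
  move=> So; apply: (@equational_of_cut _ _ _ _ _ _ o) => // F v t u vt vu.
  apply: (prov_rule (ps := [:: [:: repl F v t] ⇒ [:: repl F v t]])) => //.
    left; right; exists (right_name o) => //.
    exact: (eq_rule_right o [:: repl F v t] [::]).
  exact/all_in1.
have half_left o : S (left_name o) -> equational c R.
  move=> So; apply: (@equational_of_cut _ _ _ _ _ _ (~~ o)) => // F v t u vt vu.
  have -> : oriented (~~ o) t u = oriented o u t by case: (o).
  apply: (prov_rule (ps := [:: [:: repl F v u] ⇒ [:: repl F v u]])) => //.
    left; right; exists (left_name o) => //.
    exact: (eq_rule_left o [::] _ _ vu vt).
  exact/all_in1.
by case: e Se; [apply: (half_right true)|apply: (half_right false)
               |apply: (half_left true)|apply: (half_left false)].
Qed.

Lemma equational_reference :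
  equational c (@gentzen_cut_free L ⊎ @reflexivity_axiom L ⊎ @congruence_rule L
                ⊎ @cut_rule L).
Proof.
set R := _ ⊎ _.
have gentzen ps q : gentzen_cut_free ps q -> R ps q by left; left; left.
have refl ps q : reflexivity_axiom ps q -> R ps q by left; left; right.
have cut ps q : cut_rule ps q -> R ps q by right.
have ax F : derivable (restrict c R) ([:: F] ⇒ [:: F]) by apply: prov_axiom.
apply: (@equational_of_cut _ _ _ _ _ _ true) => // F v t u vt vu.
apply: (prov_rule (ps := [:: [:: repl F v t] ⇒ [:: repl F v t];
                             [:: repl F v u] ⇒ [:: repl F v u]])) => //.
  left; right.
  exact: (Congr [:: repl F v t] [::] [::] [:: repl F v u] F vt vu).
exact/all_in2.
Qed.

Lemma adequate_ext : (exists e, S e) -> adequate L c S.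
Proof.
move=> S_nonempty q; split=> q_der.
  have [equ_init pred_init] := equational_reference.
  by apply: prov_of_ext q_der => // ps p; left; left; left.
have [equ_init pred_init] := equational_ext S_nonempty.
by apply: prov_of_reference q_der => // ps p; left; left; left.
Qed.

Lemma cut_elimination_sufficient :
  (S Eq1 /\ S Eq2) \/ (S Eq1 /\ S Eq1l) \/ (S Eq2 /\ S Eq2l) ->
  cut_elimination L c S.
Proof.
move=> /equational_cut_free[equ_init pred_init] q q_der.
by apply: prov_of_ext q_der => //; apply: gentzen_ext_cut_free.
Qed.

Lemma distinct_fvars : exists x y z : fvar L, [/\ x != y, x != z & y != z].
Proof.
have [x _] := fvar_infinite [::]; have [y y_x] := fvar_infinite [:: x].
have [z] := fvar_infinite [:: x; y]; rewrite !inE negb_or => /andP[ne_zx ne_zy].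
by exists x, y, z; split; rewrite eq_sym //; move: y_x; rewrite inE.
Qed.

Lemma cut_elimination_necessary :
  (exists f : fun_symb L, 0 < fun_arity f) -> (exists e, S e) ->
  cut_elimination L c S ->
  (S Eq1 /\ S Eq2) \/ (S Eq1 /\ S Eq1l) \/ (S Eq2 /\ S Eq2l).
Proof.
move=> [f f_pos] S_nonempty cut_elim.
have [equ_init _] := equational_ext S_nonempty.
have derive_equ (G : seq (formula L)) t u :
    eqv G t u -> derivable (ext_cut_free c S) (G ⇒ [:: Equ t u]).
  by move=> tu; apply: cut_elim; apply: equ_init.
have [x [y [z [ne_xy ne_xz ne_yz]]]] := distinct_fvars.
have common o : S (right_name (~~ o)) \/ S (left_name o).
  case S_right: (S (right_name (~~ o))); first by left.
  case S_left: (S (left_name o)); first by right.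
  case: (common_side_underivable (c := c) (S := S) (o := o) ne_xy ne_xz ne_yz);
    rewrite ?S_right ?S_left //.
  apply: derive_equ; apply: (@eqv_trans _ _ _ (FVar z)).
    by case: (o); [|apply: eqv_sym]; apply: eqv_base; left.
  by case: (o); [apply: eqv_sym|]; apply: eqv_base; right; left.
have right_rule : S Eq1 \/ S Eq2.
  case S1: (S Eq1); first by left.
  case S2: (S Eq2); first by right.
  case: (congruence_underivable (c := c) (S := S) f_pos ne_xy); rewrite ?S1 ?S2 //.
  apply: derive_equ; apply: eqv_App => i; rewrite !ffunE.
  by apply: eqv_base; left.
have := common true; have := common false; move: right_rule => /=; tauto.
Qed.

End Main.

Theorem theorem1p7 (L : language)
    (fvar_infinite : forall vs : seq (fvar L), exists v, v \notin vs)
    (fun_positive : exists f : fun_symb L, 0 < fun_arity f)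
    (c : logic) (S : pred eq_name) (S_nonempty : exists e, S e) :
  adequate L c S /\
  (cut_elimination L c S <->
   (S Eq1 /\ S Eq2) \/ (S Eq1 /\ S Eq1l) \/ (S Eq2 /\ S Eq2l)).
Proof.
split; first exact: adequate_ext.
split; last exact: cut_elimination_sufficient.
exact: cut_elimination_necessary.
Qed.
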